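(* Let $X$ be a complete convex metric space with a base point $e$. For each $n \in \mathbb{N}$ let $X_n$ be the closed ball of radius $n$ about $e$ in $X$ (a pointed metric space with base point $e$ and the metric inherited from $X$), and suppose that $\mathrm{Lip}_0(X_n)$ has a strongly unique predual for all $n$. Then $\mathrm{Lip}_0(X)$ has a strongly unique predual.
   Context: A metric space $(X,\rho)$ is convex if for every distinct $p,q \in X$ there exists a third point $r \in X$, distinct from both $p$ and $q$, such that $\rho(p,q) = \rho(p,r) + \rho(r,q)$. For $f: X \to \mathbb{R}$, the Lipschitz number is $L(f) = \sup_{p\neq q} \frac{|f(p)-f(q)|}{\rho(p,q)}$, and $f$ is Lipschitz if $L(f) < \infty$. If $X$ is a pointed metric space (equipped with a base point $e$), $\mathrm{Lip}_0(X)$ is the real Banach space of all (possibly unbounded) Lipschitz functions $f: X \to \mathbb{R}$ with $f(e) = 0$, with norm $L(\cdot)$. The Arens-Eells space $\text{Æ}(X)$ is the closed linear subspace of $\mathrm{Lip}_0(X)^*$ generated by the point evaluations $\delta_p: f \mapsto f(p)$, $p \in X$; the natural pairing gives an isometric isomorphism $\mathrm{Lip}_0(X) \cong \text{Æ}(X)^*$, so $\mathrm{Lip}_0(X)$ is a dual Banach space. A dual Banach space $V^*$ is said to have a strongly unique predual if every (surjective, linear) isometric isomorphism between $V^*$ and another dual Banach space $W^*$ is weak* continuous. Equivalently, for a dual Banach space $E$: there is exactly one closed subspace of $E^*$ such that the weak topology it induces on $E$ makes the closed unit ball of $E$ compact Hausdorff. *)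

(* Defs.v *)
From HB Require Import structures.
From mathcomp Require Import all_boot all_order all_algebra.
From mathcomp Require Import all_classical all_reals topology normedtype.

Set Implicit Arguments.
Unset Strict Implicit.
Unset Printing Implicit Defensive.

Import Order.TTheory GRing.Theory Num.Theory.
Import numFieldNormedType.Exports.

Local Open Scope classical_set_scope.
Local Open Scope ring_scope.

Definition metric_convex (R : realType) (X : metricType R) : Prop :=
  forall p q : X, p <> q ->
    exists r : X, [/\ r <> p, r <> q & mdist p q = mdist p r + mdist r q].

(* The library's [completeType] carries a default point of its own, which
   would be unrelated to the base point, hence this Prop version. *)
Definition metric_complete (R : realType) (X : metricType R) : Prop :=
  forall F : set_system X, ProperFilter F -> cauchy F -> exists x : X, F --> x.

Section cball.
Context {R : realType} {X : metricType R}.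

(* Not the library's [closed_ball], which is the closure of the open ball. *)
Definition cball (e : X) (r : R) : Type := {x : X | mdist e x <= r}.

Variables (e : X) (r : R).

HB.instance Definition _ := SubChoice.on (cball e r).

Let dist (x y : cball e r) : R := mdist (val x) (val y).

Let distxx x : dist x x = 0. Proof. exact: mdistxx. Qed.
Let dist_positivity x y : dist x y = 0 -> x = y.
Proof. by move=> /mdist_positivity/val_inj. Qed.
Let dist_sym x y : dist x y = dist y x. Proof. exact: metric_sym. Qed.
Let dist_triangle y x z : dist x z <= dist x y + dist y z.
Proof. exact: metric_triangle. Qed.

HB.instance Definition _ := @isMetric.Build R (cball e r) dist
  distxx dist_positivity dist_sym dist_triangle.

Lemma cball_mdistE (x y : cball e r) : mdist x y = mdist (val x) (val y).
Proof. by []. Qed.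

End cball.

Section cball_center.
Context {R : realType} {X : metricType R} (e : X) (n : nat).

Fact cball_center_subproof : mdist e e <= n%:R :> R.
Proof. by rewrite mdistxx ler0n. Qed.

Definition cball_center : cball e (n%:R : R) :=
  exist _ e cball_center_subproof.

End cball_center.

Section dual.
Context {R : realType} (V : normedModType R).

Definition dual_pred : {pred V -> R} :=
  fun f => `[< linear (f : V -> R) /\ continuous (f : V -> R) >].

Record dual : Type := Dual {
  dual_fun :> V -> R;
  dual_funP : dual_fun \in dual_pred }.

HB.instance Definition _ := [isSub for dual_fun].
HB.instance Definition _ := [Choice of dual by <:].

Fact dual_submod_closed : submod_closed dual_pred.
Proof.
split.
  apply/asboolP; split; first by move=> a x y; rewrite /= scaler0 addr0.
  by move=> x; exact: cvg_cst.
move=> a f g /asboolP[lf cf] /asboolP[lg cg]; apply/asboolP; split.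
  move=> b x y; rewrite !fctE lf lg.
  by rewrite !scalerDr !scalerA mulrC addrACA.
by move=> x; apply: cvgD; [apply: cvgZr; exact: cf|exact: cg].
Qed.

HB.instance Definition _ :=
  GRing.isSubmodClosed.Build R (V -> R) dual_pred dual_submod_closed.
HB.instance Definition _ := [SubChoice_isSubLmodule of dual by <:].

Implicit Types f g : dual.

Lemma dualP f g : f =1 g -> f = g.
Proof. by move=> fg; apply/val_inj/funext. Qed.

Lemma dual_linear f : linear (f : V -> R).
Proof. by have /asboolP[] := dual_funP f. Qed.

Lemma dual_continuous f : continuous (f : V -> R).
Proof. by have /asboolP[] := dual_funP f. Qed.

HB.instance Definition _ f :=
  GRing.isLinear.Build R V R *:%R (dual_fun f) (dual_linear f).

Lemma dualDE f g x : (f + g) x = f x + g x. Proof. by []. Qed.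
Lemma dualNE f x : (- f) x = - f x. Proof. by []. Qed.
Lemma dualZE (a : R) f x : (a *: f) x = a * f x. Proof. by []. Qed.
Lemma dual0E x : (0 : dual) x = 0. Proof. by []. Qed.

Definition dual_norm f : R := sup [set `|f x| | x in [set x : V | `|x| <= 1]].

Let dual_bounded f : exists2 k : R, 0 <= k & forall x, `|f x| <= k * `|x|.
Proof.
have /linear_bounded_continuous/linear_boundedP := @dual_continuous f.
by move=> /pinfty_ex_gt0[k k0 fk]; exists k => //; exact: ltW.
Qed.

Let dual_has_sup f : has_sup [set `|f x| | x in [set x : V | `|x| <= 1]].
Proof.
split; first by exists `|f 0|, 0 => //=; rewrite normr0.
have [k k0 fk] := dual_bounded f; exists k => _ [x x1 <-].
by rewrite (le_trans (fk x))// ler_piMr.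
Qed.

Let dual_norm_le f x : `|f x| <= dual_norm f * `|x|.
Proof.
have [->|x0] := eqVneq x 0; first by rewrite linear0 !normr0 mulr0.
rewrite -ler_pdivrMr ?normr_gt0//.
apply: (ub_le_sup (dual_has_sup f).2); exists (`|x|^-1 *: x).
  by rewrite /= normrZ normfV normr_id mulVf// normr_eq0.
by rewrite linearZ/= normrM normfV normr_id mulrC.
Qed.

Let dual_norm_ge f (k : R) : 0 <= k -> (forall x, `|f x| <= k * `|x|) ->
  dual_norm f <= k.
Proof.
move=> k0 fk; apply: ge_sup; first exact: (dual_has_sup f).1.
by move=> _ [x x1 <-]; rewrite (le_trans (fk x))// ler_piMr.
Qed.

Let dual_norm_ge0 f : 0 <= dual_norm f.
Proof.
apply: le_trans (ub_le_sup (dual_has_sup f).2 _); first exact: (normr_ge0 (f 0)).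
by exists 0 => //=; rewrite normr0.
Qed.

Let dual_normD f g : dual_norm (f + g) <= dual_norm f + dual_norm g.
Proof.
apply: dual_norm_ge => [|x]; first by rewrite addr_ge0.
by rewrite dualDE mulrDl (le_trans (ler_normD _ _))// lerD.
Qed.

Let dual_normZ_le (a : R) f : dual_norm (a *: f) <= `|a| * dual_norm f.
Proof.
apply: dual_norm_ge => [|x]; first by rewrite mulr_ge0.
by rewrite dualZE normrM -mulrA ler_wpM2l.
Qed.

Let dual_normZ (a : R) f : dual_norm (a *: f) = `|a| * dual_norm f.
Proof.
apply/eqP; rewrite eq_le dual_normZ_le/=.
have [->|a0] := eqVneq a 0; first by rewrite normr0 mul0r.
rewrite -ler_pdivlMl ?normr_gt0// -normfV.
by apply: le_trans (dual_normZ_le _ _); rewrite scalerA mulVf// scale1r.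
Qed.

Let dual_norm0_eq0 f : dual_norm f = 0 -> f = 0.
Proof.
move=> f0; apply: dualP => x; apply/eqP; rewrite dual0E -normr_le0.
by rewrite (le_trans (dual_norm_le _ _))// f0 mul0r.
Qed.

HB.instance Definition _ :=
  @Lmodule_isNormed.Build R dual dual_norm dual_normD dual_normZ dual_norm0_eq0.

Lemma dual_normE f :
  `|f| = sup [set `|f x| | x in [set x : V | `|x| <= 1]].
Proof. by []. Qed.

Lemma ler_dual_norm f x : `|f x| <= `|f| * `|x|.
Proof. exact: dual_norm_le. Qed.

Lemma dual_norm_ler f (k : R) : 0 <= k -> (forall x, `|f x| <= k * `|x|) ->
  `|f| <= k.
Proof. exact: dual_norm_ge. Qed.

Lemma dual_mk_subproof (f : V -> R) (k : R) :
  linear f -> (forall x, `|f x| <= k * `|x|) -> f \in dual_pred.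
Proof.
move=> lf fk; apply/asboolP; split => //.
pose F : {linear V -> R} := HB.pack f (GRing.isLinear.Build _ _ _ _ _ lf).
apply: (@bounded_linear_continuous _ _ _ F); apply/linear_boundedP.
near=> r => x; rewrite (le_trans (fk x))// ler_wpM2r//.
by near: r; apply: nbhs_pinfty_ge; rewrite num_real.
Unshelve. all: by end_near. Qed.

Let dual_complete (F : set_system dual) : ProperFilter F -> cauchy F -> cvg F.
Proof.
move=> FF /cauchyP Fc.
have Fx x : cvg ((fun f : dual => f x) @ F).
  apply: R_complete; apply: cauchy_exP => eps eps0.
  have eps1 : 0 < eps / (`|x| + 1) by rewrite divr_gt0// ltr_wpDl.
  have [f Ff] := Fc _ eps1.
  exists (f x); suff : F [set g : dual | ball (f x) eps (g x)] by [].
  apply: filterS Ff => g; rewrite -!ball_normE/= => fg.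
  rewrite -[_ - _]/((f - g) x) (le_lt_trans (ler_dual_norm _ _))//.
  rewrite (@le_lt_trans _ _ (`|f - g| * (`|x| + 1)))//.
    by rewrite ler_wpM2l// lerDl.
  by rewrite -ltr_pdivlMr// ltr_wpDl.
pose l x : R := lim ((fun f : dual => f x) @ F).
have ll : linear l.
  move=> a x y; apply: cvg_lim => //.
  under eq_fun do rewrite linearP.
  by apply: cvgD; [apply: cvgZr|]; exact: Fx.
have lF (f : dual) e : F (ball f e) -> forall x, `|f x - l x| <= e * `|x|.
  move=> Ff x.
  have : (fun g : dual => `|f x - g x|) @ F --> `|f x - l x|.
    by apply: cvg_norm; apply: cvgB; [exact: cvg_cst|exact: Fx].
  move=> H; rewrite -(cvg_lim _ H)//; apply: limr_le.
    by apply/cvg_ex; eexists; exact: H.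
  apply: filterS Ff => g; rewrite -ball_normE/= => /ltW fg.
  rewrite -[_ - _]/((f - g) x) (le_trans (ler_dual_norm _ _))//.
  by rewrite ler_wpM2r.
have [f1 Ff1] := Fc 1 ltr01.
have lb x : `|l x| <= (1 + `|f1|) * `|x|.
  rewrite -[l x](subKr (f1 x)) (le_trans (ler_normB _ _))// addrC mulrDl.
  by rewrite lerD ?lF// ler_dual_norm.
pose L : dual := Dual (dual_mk_subproof ll lb).
apply/cvg_ex; exists L; apply/cvgrPdist_le => eps eps0.
have [f Ff] := Fc (eps / 2) (divr_gt0 eps0 (ltr0Sn _ 1)).
apply: filterS (Ff) => g; rewrite -ball_normE/= => /ltW fg.
apply: dual_norm_ler => [|x]; first exact: ltW.
rewrite -[(L - g) x]/(l x - g x) -(subrKA (f x)) (le_trans (ler_normD _ _))//.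
rewrite [eps]splitr mulrDl lerD//; first by rewrite distrC lF.
rewrite -[_ - _]/((f - g) x) (le_trans (ler_dual_norm _ _))//.
by rewrite ler_wpM2r.
Qed.

HB.instance Definition _ := Uniform_isComplete.Build dual dual_complete.

End dual.

Section closed_span.
Context {R : realType} {V : completeNormedModType R}.

Definition closed_subspace (A : set V) : Prop :=
  [/\ A 0, forall (a : R) u v, A u -> A v -> A (a *: u + v) & closed A].

Definition closed_span (G : set V) : set V := smallest closed_subspace G.

Variable G : set V.

Lemma closed_span_closed_subspace : closed_subspace (closed_span G).
Proof.
split=> [A [[A0 _ _] _]//|a u v Gu Gv A [[A0 AD Ac] GA]|].
  have GA' : [set M | closed_subspace M /\ G `<=` M] A by [].
  exact: AD (Gu A GA') (Gv A GA').
apply: closed_bigI => A [[_ _ Ac] _].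
exact: Ac.
Qed.

Definition closed_span_pred : {pred V} := fun x => `[< closed_span G x >].

Record closed_span_type : Type := ClosedSpan {
  closed_span_val :> V;
  closed_span_valP : closed_span_val \in closed_span_pred }.

HB.instance Definition _ := [isSub for closed_span_val].
HB.instance Definition _ := [Choice of closed_span_type by <:].

Fact closed_span_submod_closed : submod_closed closed_span_pred.
Proof.
have [G0 GD _] := closed_span_closed_subspace.
split; first exact/asboolP.
move=> a u v /asboolP Gu /asboolP Gv; apply/asboolP.
exact: GD.
Qed.

HB.instance Definition _ :=
  GRing.isSubmodClosed.Build R V closed_span_pred closed_span_submod_closed.
HB.instance Definition _ := [SubChoice_isSubLmodule of closed_span_type by <:].

Let norm (x : closed_span_type) : R := `|val x|.

Let ler_normD x y : norm (x + y) <= norm x + norm y.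
Proof. exact: ler_normD. Qed.
Let normrZ (a : R) x : norm (a *: x) = `|a| * norm x.
Proof. exact: normrZ. Qed.
Let normr0_eq0 x : norm x = 0 -> x = 0.
Proof. by move=> /normr0_eq0 x0; exact: val_inj. Qed.

HB.instance Definition _ :=
  @Lmodule_isNormed.Build R closed_span_type norm ler_normD normrZ normr0_eq0.

Lemma closed_span_normE (x : closed_span_type) : `|x| = `|val x|.
Proof. by []. Qed.

Let complete (F : set_system closed_span_type) :
  ProperFilter F -> cauchy F -> cvg F.
Proof.
move=> FF /cauchyP Fc.
have /cvg_ex[/= l Fl] : cvg ((val : closed_span_type -> V) @ F).
  apply: cauchy_cvg; apply: cauchy_exP => e e0.
  have [x Fx] := Fc e e0; exists (val x).
  suff : F [set y | ball (val x) e (val y)] by [].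
  by apply: filterS Fx => y; rewrite -!ball_normE.
have Gl : l \in closed_span_pred.
  apply/asboolP; have [_ _ Gc] := closed_span_closed_subspace.
  apply: (@closed_cvg _ _ F _ closed_span_val _ Gc _ _ Fl).
  apply: nearW => x; apply/asboolP; exact: closed_span_valP.
apply/cvg_ex; exists (ClosedSpan Gl); apply/cvgrPdist_le => e e0.
by move/cvgrPdist_le : Fl => /(_ e e0).
Qed.

HB.instance Definition _ := Uniform_isComplete.Build closed_span_type complete.

End closed_span.

Section lipschitz.
Context {R : realType} {X : metricType R}.

Definition lip_quotients (f : X -> R) : set R :=
  [set `|f pq.1 - f pq.2| / mdist pq.1 pq.2 | pq in [set pq | pq.1 <> pq.2]].

Definition lipschitz (f : X -> R) : Prop := has_ubound (lip_quotients f).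

(* If [X] is a singleton there are no quotients, and [sup set0 = 0]. *)
Definition lip_number (f : X -> R) : R := sup (lip_quotients f).

Lemma lipschitz_le (f : X -> R) p q : lipschitz f ->
  `|f p - f q| <= lip_number f * mdist p q.
Proof.
move=> lf; have [->|/eqP pq] := eqVneq p q.
  by rewrite subrr normr0 mdistxx mulr0.
rewrite -ler_pdivrMr ?mdist_gt0; last exact/eqP.
by apply: ub_le_sup => //; exists (p, q).
Qed.

Lemma lipschitz_mk (f : X -> R) (k : R) :
  (forall p q, `|f p - f q| <= k * mdist p q) -> lipschitz f.
Proof.
move=> fk; exists k => _ [[p q] /= pq <-].
by rewrite ler_pdivrMr ?mdist_gt0//; exact/eqP.
Qed.

Lemma lip_number_le (f : X -> R) (k : R) : 0 <= k ->
  (forall p q, `|f p - f q| <= k * mdist p q) -> lip_number f <= k.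
Proof.
move=> k0 fk; rewrite /lip_number.
have [->|/set0P f0] := eqVneq (lip_quotients f) set0; first by rewrite sup0.
apply: ge_sup => // _ [[p q] /= pq <-].
by rewrite ler_pdivrMr ?mdist_gt0//; exact/eqP.
Qed.

Lemma lip_number_ge0 (f : X -> R) : 0 <= lip_number f.
Proof.
rewrite /lip_number; have [fS|fS] := pselect (has_sup (lip_quotients f)).
  have [[r [pq pqne pqr]] fub] := fS.
  apply: (@le_trans _ _ r); first by rewrite -pqr divr_ge0// mdist_ge0.
  by apply: ub_le_sup => //; exists pq.
by rewrite sup_out.
Qed.

End lipschitz.

Section Lip0.
Context {R : realType} {X : metricType R} (e : X).

Definition Lip0_pred : {pred X -> R} := fun f => `[< lipschitz f /\ f e = 0 >].

Record Lip0 : Type := MkLip0 {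
  Lip0_fun :> X -> R;
  Lip0_funP : Lip0_fun \in Lip0_pred }.

HB.instance Definition _ := [isSub for Lip0_fun].
HB.instance Definition _ := [Choice of Lip0 by <:].

Let lip_comb_le (a : R) (f g : X -> R) p q : lipschitz f -> lipschitz g ->
  `|(a *: f + g) p - (a *: f + g) q| <=
  (`|a| * lip_number f + lip_number g) * mdist p q.
Proof.
move=> lf lg.
have -> : (a *: f + g) p - (a *: f + g) q = a * (f p - f q) + (g p - g q).
  by rewrite !fctE mulrBr addrACA opprD.
rewrite (le_trans (ler_normD _ _))// mulrDl lerD//; last exact: lipschitz_le.
by rewrite normrM -mulrA ler_wpM2l//; exact: lipschitz_le.
Qed.

Fact Lip0_submod_closed : submod_closed Lip0_pred.
Proof.
split.
  apply/asboolP; split => //; apply: (@lipschitz_mk _ _ _ 0) => p q.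
  by rewrite subrr normr0 mul0r.
move=> a f g /asboolP[lf f0] /asboolP[lg g0]; apply/asboolP; split.
  by apply: lipschitz_mk => p q; exact: lip_comb_le.
by rewrite !fctE f0 g0 scaler0 addr0.
Qed.

HB.instance Definition _ :=
  GRing.isSubmodClosed.Build R (X -> R) Lip0_pred Lip0_submod_closed.
HB.instance Definition _ := [SubChoice_isSubLmodule of Lip0 by <:].

Implicit Types f g : Lip0.

Lemma Lip0P f g : f =1 g -> f = g.
Proof. by move=> fg; apply/val_inj/funext. Qed.

Lemma Lip0_lipschitz f : lipschitz f.
Proof. by have /asboolP[] := Lip0_funP f. Qed.

Lemma Lip0_base f : f e = 0.
Proof. by have /asboolP[] := Lip0_funP f. Qed.

Lemma Lip0DE f g p : (f + g) p = f p + g p. Proof. by []. Qed.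
Lemma Lip0NE f p : (- f) p = - f p. Proof. by []. Qed.
Lemma Lip0ZE (a : R) f p : (a *: f) p = a * f p. Proof. by []. Qed.
Lemma Lip00E p : (0 : Lip0) p = 0. Proof. by []. Qed.

Let norm f : R := lip_number f.

Let ler_normD f g : norm (f + g) <= norm f + norm g.
Proof.
apply: lip_number_le => [|p q]; first by rewrite addr_ge0// lip_number_ge0.
have := lip_comb_le 1 p q (Lip0_lipschitz f) (Lip0_lipschitz g).
by rewrite normr1 mul1r scale1r.
Qed.

Let normrZ_le (a : R) f : norm (a *: f) <= `|a| * norm f.
Proof.
apply: lip_number_le => [|p q]; first by rewrite mulr_ge0// lip_number_ge0.
rewrite !Lip0ZE -mulrBr normrM -mulrA ler_wpM2l//.
exact/lipschitz_le/Lip0_lipschitz.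
Qed.

Let normrZ (a : R) f : norm (a *: f) = `|a| * norm f.
Proof.
apply/eqP; rewrite eq_le normrZ_le/=.
have [->|a0] := eqVneq a 0; first by rewrite normr0 mul0r lip_number_ge0.
rewrite -ler_pdivlMl ?normr_gt0// -normfV.
by apply: le_trans (normrZ_le _ _); rewrite scalerA mulVf// scale1r.
Qed.

Let normr0_eq0 f : norm f = 0 -> f = 0.
Proof.
move=> f0; apply: Lip0P => p; apply/eqP; rewrite Lip00E -normr_le0.
have -> : f p = f p - f e by rewrite Lip0_base subr0.
apply: le_trans (lipschitz_le p e (Lip0_lipschitz f)) _.
rewrite (_ : lip_number f = 0); last exact: f0.
by rewrite mul0r.
Qed.

HB.instance Definition _ :=
  @Lmodule_isNormed.Build R Lip0 norm ler_normD normrZ normr0_eq0.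

Lemma Lip0_normE f : `|f| = lip_number f. Proof. by []. Qed.

Fact lip_eval_subproof p : (fun f : Lip0 => f p) \in @dual_pred R Lip0.
Proof.
apply: (@dual_mk_subproof _ _ _ (mdist p e)) => // f.
rewrite -[f p]subr0 -(Lip0_base f) mulrC.
exact: lipschitz_le (Lip0_lipschitz f).
Qed.

Definition lip_eval (p : X) : dual Lip0 := Dual (lip_eval_subproof p).

Definition arens_eells : completeNormedModType R :=
  closed_span_type (range lip_eval).

Lemma arens_eells_evalP p : lip_eval p \in closed_span_pred (range lip_eval).
Proof. by apply/asboolP; apply: sub_gen_smallest; exists p. Qed.

Definition ae_eval (p : X) : arens_eells := ClosedSpan (arens_eells_evalP p).

Fact Lip0_dual_subproof f :
  (fun m : arens_eells => closed_span_val m f) \in @dual_pred R arens_eells.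
Proof.
apply: (@dual_mk_subproof _ _ _ `|f|) => // m.
by rewrite mulrC; exact: ler_dual_norm.
Qed.

(* The natural pairing <f, m> = m(f), curried as a map f |-> <f, _>. *)
Definition Lip0_dual f : dual arens_eells := Dual (Lip0_dual_subproof f).

End Lip0.

Definition isometric_isomorphism (R : realType) (E F : normedModType R)
    (T : E -> F) : Prop :=
  [/\ linear T, forall x, `|T x| = `|x| & forall y, exists x, T x = y].

(* A dual Banach space is a normed space together with a fixed isometric
   identification with the dual of a Banach space; this choice is what the
   weak* topology depends on. *)
Record dualBanach (R : realType) : Type := DualBanach {
  dualBanach_space :> normedModType R;
  predual : completeNormedModType R;
  predual_iso : dualBanach_space -> dual predual;
  predual_isoP : isometric_isomorphism predual_iso }.

Fact id_isometric_isomorphism (R : realType) (E : normedModType R) :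
  isometric_isomorphism (@id E).
Proof. by split => // y; exists y. Qed.

Definition dual_dualBanach (R : realType) (V : completeNormedModType R) :
  dualBanach R := DualBanach (id_isometric_isomorphism (dual V)).

Definition weak_star (R : realType) (E : dualBanach R) : Type :=
  @initial_topology E {ptws predual E -> R} (@predual_iso R E).

HB.instance Definition _ (R : realType) (E : dualBanach R) :=
  Topological.copy (weak_star E)
    (@initial_topology E {ptws predual E -> R} (@predual_iso R E)).

Definition weak_star_continuous (R : realType) (E F : dualBanach R)
  (T : E -> F) : Prop := continuous (T : weak_star E -> weak_star F).

Definition strongly_unique_predual (R : realType) (E : dualBanach R) : Prop :=
  forall (F : dualBanach R) (T : E -> F),
    isometric_isomorphism T -> weak_star_continuous T.

Section Lip0_dualBanach.
Context {R : realType} {X : metricType R} (e : X).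

Lemma ae_eval_dist p q : `|ae_eval e p - ae_eval e q| <= mdist p q.
Proof.
rewrite closed_span_normE; apply: dual_norm_ler => [|f]; first exact: mdist_ge0.
by rewrite mulrC; exact/lipschitz_le/Lip0_lipschitz.
Qed.

Lemma Lip0_dual_isometric_isomorphism : isometric_isomorphism (@Lip0_dual R X e).
Proof.
split=> [a f g|f|m].
- by apply: dualP => m; exact: (dual_linear (closed_span_val m)).
- apply/eqP; rewrite eq_le; apply/andP; split.
    apply: dual_norm_ler => // m.
    by rewrite mulrC; exact: (ler_dual_norm (closed_span_val m) f).
  rewrite Lip0_normE; apply: lip_number_le => // p q.
  rewrite -[f p - f q]/(Lip0_dual f (ae_eval e p - ae_eval e q)).
  by rewrite (le_trans (ler_dual_norm _ _))// ler_wpM2l// ae_eval_dist.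
pose f p := m (ae_eval e p).
have fP : f \in Lip0_pred e.
  apply/asboolP; split.
    apply: (@lipschitz_mk _ _ _ `|m|) => p q.
    rewrite /f -linearB (le_trans (ler_dual_norm _ _))//.
    by rewrite ler_wpM2l// ae_eval_dist.
  rewrite /f (_ : ae_eval e e = 0) ?linear0//.
  by apply/val_inj/dualP => g; exact: Lip0_base.
exists (MkLip0 fP); apply: dualP => -[u uP].
pose g := MkLip0 fP; rewrite -/g.
pose A := [set u : dual (Lip0 e) | closed_span (range (@lip_eval R X e)) u /\
  forall uP : u \in closed_span_pred (range (@lip_eval R X e)),
    m (ClosedSpan uP) = u g].
suff Au : A u by rewrite (Au.2 uP).
have [S0 SD Sc] := closed_span_closed_subspace (range (@lip_eval R X e)).
have Su : closed_span (range (@lip_eval R X e)) u by exact/asboolP.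
apply: (@smallest_sub _ closed_subspace (range (@lip_eval R X e)) A _ _ u Su).
- split=> [|a v w [Sv Av] [Sw Aw]|].
  + split=> // P; rewrite (_ : ClosedSpan P = 0) ?linear0//.
    exact: val_inj.
  + split; first exact: SD.
    move=> P; have vP : v \in closed_span_pred (range (@lip_eval R X e)).
      exact/asboolP.
    have wP : w \in closed_span_pred (range (@lip_eval R X e)) by exact/asboolP.
    rewrite (_ : ClosedSpan P = a *: ClosedSpan vP + ClosedSpan wP).
      rewrite dual_linear -[RHS]/(a * v g + w g) -(Av vP) -(Aw wP).
      by [].
    exact: val_inj.
  + move=> v cv; have Sv : closed_span (range (@lip_eval R X e)) v.
      by apply: Sc => B /cv[w [[Sw _] Bw]]; exists w.
    split=> // P; apply/eqP; rewrite -subr_eq0 -normr_le0.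
    apply/ler_addgt0Pl => eps eps0; rewrite addr0.
    have k0 : 0 < eps / (`|m| + `|g| + 1) by rewrite divr_gt0// ltr_wpDl// addr_ge0.
    have /cv[w [[Sw Aw] /=]] := nbhsx_ballx v _ k0.
    rewrite -ball_normE/= => /ltW vw.
    have wP : w \in closed_span_pred (range (@lip_eval R X e)) by exact/asboolP.
    rewrite -(subrKA (w g)) -(Aw wP) -linearB.
    rewrite (le_trans (ler_normD _ _))//.
    rewrite (@le_trans _ _ ((`|m| + `|g|) * `|v - w|))//.
      rewrite mulrDl lerD//; first exact: ler_dual_norm.
      rewrite (Aw wP) (mulrC `|g|) (distrC v w).
      exact: (ler_dual_norm (w - v) g).
    rewrite (@le_trans _ _ ((`|m| + `|g| + 1) * `|v - w|))//.
      by rewrite ler_wpM2r// lerDl.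
    by rewrite -ler_pdivlMl ?ltr_wpDl ?addr_ge0// mulrC.
- move=> _ [p _ <-]; split; first by apply: sub_gen_smallest; exists p.
  by move=> P; congr (m _); exact: val_inj.
Qed.

Definition Lip0_dualBanach : dualBanach R :=
  DualBanach Lip0_dual_isometric_isomorphism.

End Lip0_dualBanach.

(* Main.v *)
Require Import Defs.
From HB Require Import structures.
From mathcomp Require Import all_boot all_order all_algebra.
From mathcomp Require Import all_classical all_reals topology normedtype.
From mathcomp Require Import sequences lra ring.

(** Let [T] be an isometric isomorphism of Lip_0(X) onto a dual space, and
    compose it with the identification of that space with a dual [W^*] to get
    [S : Lip_0(X) -> W^*].  The map [T] is weak* continuous as soon as, for
    every [w] in [W], the functional [f |-> S f w] belongs to the Arens-Eells
    space of [X].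

    Write [X_n] for the closed ball of radius [n] about [e], [I_n] for the
    space of functions in Lip_0(X) that vanish on [X_n], and [N_n] for the
    subspace of [W] annihilated by [S I_n].  Restriction to [X_n] identifies
    Lip_0(X_n) isometrically with Lip_0(X) / I_n, by McShane's extension
    theorem.  If [S I_n] is the whole annihilator of [N_n], then [S] induces
    an isometric isomorphism of Lip_0(X_n) onto the dual of [N_n], and the
    uniqueness hypothesis for [X_n] puts [f |-> S f w] in the Arens-Eells space
    of [X_n], hence of [X], for every [w] in [N_n].  The union of the [N_n] is
    total in [W], because a function vanishing on every [X_n] is zero; as the
    Arens-Eells space is norm closed, this settles all [w] in [W].

    The point is thus that [S I_n] is weak* closed, although nothing is known
    about the topology that [W] induces on Lip_0(X).  Here convexity enters
    (lemma [lens_peak]).  A complete convex space has points at every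
    intermediate distance between two given points (Menger,
    [metric_between]), and this implies that the unit ball of [I_n] is the
    intersection of two balls of radius 1, centred at [g] and [-g], where
    [g = max(0, min(d(e,.), n - d(e,.)))].  That description is isometric, so
    it survives [S]: with [a = S g], the unit ball of [S I_n] is the set, called
    a lens here, of the [y] with [|y + a| <= 1] and [|y - a| <= 1].

    For such a set no compactness argument is needed to pass to the
    annihilator ([lens_annihilator]).  The lens consists of the linear
    functionals below both [|.| - a] and [|.| + a], that is, below their infimal
    convolution [p].  By the Hahn-Banach theorem, each [w] with [p w < d] is the
    sum of a vector of norm less than [d] and one where [p] is less than
    [d / 2]; iterating, [w] is within [2 d] of [N_n].  A functional that
    vanishes on [N_n] is therefore below a multiple of [p], so it is a multiple
    of an element of the lens. *)

Set Implicit Arguments.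
Unset Strict Implicit.
Unset Printing Implicit Defensive.

Import Order.TTheory GRing.Theory Num.Theory.
Import numFieldNormedType.Exports.

Local Open Scope classical_set_scope.
Local Open Scope ring_scope.

(** * Sublinear functionals and the Hahn-Banach theorem *)

Section Sublinear.
Context {R : realType} {V : lmodType R}.
Implicit Types (p q : V -> R) (C : set (V * R)).

(** Subadditive and positively homogeneous; the inequality in the second
    clause implies equality. *)
Definition sublinear q : Prop :=
  (forall x y, q (x + y) <= q x + q y) /\
  (forall t x, 0 <= t -> q (t *: x) <= t * q x).

Lemma sublinear0 q : sublinear q -> q 0 = 0.
Proof.
move=> [qD qZ]; apply/eqP; rewrite eq_le; apply/andP; split.
  by have := qZ 0 0 (lexx 0); rewrite scale0r mul0r.
by have := qD 0 0; rewrite addr0 -lerBlDr subrr.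
Qed.

Lemma sublinearN q x : sublinear q -> - q (- x) <= q x.
Proof.
by move=> sq; have := sq.1 x (- x); rewrite subrr sublinear0//; lra.
Qed.

(** The infimum of [q (x + c) + s] over the pairs [(c, s)] in [C].  When [C] is
    a convex cone, this lowers the sublinear functional [q] so that it is at
    most [s] at [- c]. *)
Definition cone_inf q C (x : V) : R := inf [set q (x + c.1) + c.2 | c in C].

(** A convex cone on which [q c + s] is nonnegative; this is what keeps the
    infimum finite. *)
Definition dominating_cone q C : Prop :=
  [/\ C (0, 0), forall c d, C c -> C d -> C (c + d),
    forall (t : R) c, 0 <= t -> C c -> C (t *: c.1, t * c.2) &
    forall c, C c -> 0 <= q c.1 + c.2].

Section cone_inf.
Variables (q : V -> R) (C : set (V * R)).
Hypotheses (q_sublinear : sublinear q) (qC : dominating_cone q C).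

Lemma cone_inf_le x c : C c -> cone_inf q C x <= q (x + c.1) + c.2.
Proof.
move=> Cc; apply: ge_inf; last by exists c.
exists (- q (- x)) => _ [d Cd <-]; have [_ _ _ /(_ _ Cd) qd] := qC.
have := q_sublinear.1 (x + d.1) (- x).
by rewrite addrAC subrr add0r; lra.
Qed.

Lemma cone_inf_ge x k : (forall c, C c -> k <= q (x + c.1) + c.2) ->
  k <= cone_inf q C x.
Proof.
move=> kq; apply: lb_le_inf => [|_ [c Cc <-]]; last exact: kq.
by exists (q (x + 0) + 0), (0, 0) => //; case: qC.
Qed.

Lemma cone_inf_le_self x : cone_inf q C x <= q x.
Proof. by have [C0 _ _ _] := qC; have := cone_inf_le x C0; rewrite !addr0. Qed.

Lemma cone_infN c : C c -> cone_inf q C (- c.1) <= c.2.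
Proof.
by move=> /(cone_inf_le (- c.1)); rewrite addNr sublinear0// add0r.
Qed.

Lemma sublinear_cone_inf : sublinear (cone_inf q C).
Proof.
have [C0 CD CZ _] := qC; split => [x y|t x].
  rewrite -lerBlDr; apply: cone_inf_ge => c Cc.
  rewrite lerBlDr -lerBlDl; apply: cone_inf_ge => d Cd.
  have := cone_inf_le (x + y) (CD _ _ Cc Cd).
  have := q_sublinear.1 (x + c.1) (y + d.1).
  by rewrite addrACA /=; lra.
rewrite le_eqVlt => /predU1P[<-|t0].
  rewrite scale0r mul0r.
  by have := cone_inf_le_self 0; rewrite (sublinear0 q_sublinear).
rewrite -ler_pdivrMl//; apply: cone_inf_ge => c Cc.
rewrite ler_pdivrMl// (le_trans (cone_inf_le _ (CZ _ _ (ltW t0) Cc)))//=.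
by rewrite -scalerDr mulrDr lerD2r q_sublinear.2// ltW.
Qed.

End cone_inf.

(** The ray along which lowering [q] forces its value at [- v] down to
    [- q v]. *)
Let ray q v : set (V * R) :=
  [set c | exists2 t : R, 0 <= t & c = (t *: v, - (t * q v))].

Let dominating_ray q v : sublinear q -> dominating_cone q (ray q v).
Proof.
move=> sq; split.
- by exists 0 => //; rewrite scale0r mul0r oppr0.
- move=> _ _ [s s0 ->] [t t0 ->]; exists (s + t); first exact: addr_ge0.
  by rewrite scalerDl mulrDl opprD.
- move=> t _ t0 [s s0 ->]; exists (t * s); first exact: mulr_ge0.
  by rewrite /= scalerA mulrN mulrA.
- move=> _ [t t0 ->] /=; rewrite subr_ge0.
  have [->|t1] := eqVneq t 0; first by rewrite scale0r mul0r sublinear0.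
  rewrite -ler_pdivlMl ?lt0r ?t1// -{1}[v](scalerK t1); apply: sq.2.
  by rewrite invr_ge0.
Qed.

Let ray_self q v : ray q v (v, - q v).
Proof. by exists 1 => //; rewrite scale1r mul1r. Qed.

Let minorant p : Type := {q : V -> R | sublinear q /\ forall x, q x <= p x}.

(** Zorn's lemma, for the pointwise infimum of a chain. *)
Lemma minimal_sublinear p : sublinear p ->
  exists2 q, sublinear q /\ (forall x, q x <= p x) &
    forall q', sublinear q' -> (forall x, q' x <= q x) -> q' = q.
Proof.
move=> sp.
pose ge (q q' : minorant p) := `[< forall x, sval q' x <= sval q x >].
have [|s r t|s t|A totA|[q qP] qmin] := @Zorn (minorant p) ge.
- by move=> q; apply/asboolP.
- by move=> /asboolP sr /asboolP rt; apply/asboolP => x; exact: le_trans (sr x).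
- move: s t => [s sP] [t tP] /asboolP st /asboolP ts; apply: eq_exist => /=.
  by apply/funext => x; apply/eqP; rewrite eq_le ts st.
- (* The empty chain is bounded by [p] itself. *)
  have [->|/set0P[q0 Aq0]] := eqVneq A set0.
    by exists (exist _ p (conj sp (fun=> lexx _))).
  pose i x := inf [set sval q x | q in A].
  have i_le (q : minorant p) x : A q -> i x <= sval q x.
    move=> Aq; apply: ge_inf; last by exists q.
    exists (- p (- x)) => _ [q' _ <-]; have [sq' q'p] := svalP q'.
    by have := sublinearN x sq'; have := q'p (- x); lra.
  have i_ge k x : (forall q : minorant p, A q -> k <= sval q x) -> k <= i x.
    move=> kq; apply: lb_le_inf => [|_ [q Aq <-]]; last exact: kq.
    by exists (sval q0 x), q0.
  have iP : sublinear i /\ forall x, i x <= p x.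
    split; last first.
      by move=> x; apply: le_trans (i_le _ _ Aq0) _; exact: (svalP q0).2.
    split=> [x y|t x].
      rewrite -lerBlDr; apply: (i_ge) => q Aq.
      rewrite lerBlDr -lerBlDl; apply: i_ge => q' Aq'; rewrite lerBlDr.
      have [/asboolP|/asboolP] := totA _ _ Aq Aq' => /(_ _) qq'.
        have := i_le _ (x + y) Aq'; have := (svalP q').1.1 x y.
        by have := qq' x; lra.
      have := i_le _ (x + y) Aq; have := (svalP q).1.1 x y.
      by have := qq' y; lra.
    rewrite le_eqVlt => /predU1P[<-|t0].
      rewrite scale0r mul0r (le_trans (i_le _ _ Aq0))//.
      by rewrite sublinear0//; exact: (svalP q0).1.
    rewrite -ler_pdivrMl//; apply: (i_ge) => q Aq.
    rewrite ler_pdivrMl// (le_trans (i_le _ _ Aq))//.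
    by apply: (svalP q).1.2; exact: ltW.
  by exists (exist _ i iP) => s As; apply/asboolP => x; exact: i_le.
exists q => // q' sq' q'q.
have q'P : sublinear q' /\ forall x, q' x <= p x.
  by split=> // x; apply: le_trans (q'q x) (qP.2 x).
exact: (congr1 (fun r : minorant p => sval r)
  (qmin (exist _ q' q'P) (asboolT q'q))).
Qed.

Theorem linear_minorant p : sublinear p ->
  exists2 z : V -> R, linear z & forall x, z x <= p x.
Proof.
move=> /minimal_sublinear[z [sz zp] zmin]; exists z => //.
have zD x y : z (x + y) = z x + z y.
  apply/eqP; rewrite eq_le sz.1/=.
  (* Lowering [z] along the ray of [y] changes nothing, by minimality. *)
  have zC := dominating_ray y sz.
  have zE := zmin _ (sublinear_cone_inf sz zC) (cone_inf_le_self sz zC).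
  by have := cone_inf_le sz zC x (ray_self z y); rewrite zE /=; lra.
have zN x : z (- x) = - z x.
  by have := zD x (- x); rewrite subrr sublinear0//; lra.
have zZ t x : 0 <= t -> z (t *: x) = t * z x.
  move=> t0; apply/eqP; rewrite eq_le sz.2//=.
  by have := sz.2 t (- x) t0; rewrite scalerN !zN mulrN lerN2.
move=> t x y; rewrite zD; congr +%R.
have [t0|t0] := leP 0 t; first exact: zZ.
rewrite -[LHS]opprK -zN -scaleNr zZ ?oppr_ge0 ?ltW//.
by rewrite mulNr opprK.
Qed.

Corollary linear_minorant_at p v : sublinear p ->
  exists z : V -> R, [/\ linear z, forall x, z x <= p x & z v = p v].
Proof.
move=> sp.
have pC := dominating_ray v sp.
have [z lz zp] := linear_minorant (sublinear_cone_inf sp pC).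
have zp' x : z x <= p x by rewrite (le_trans (zp x))// cone_inf_le_self.
exists z; split => //; apply/eqP; rewrite eq_le zp'/=.
have := le_trans (zp _) (cone_infN sp pC (ray_self p v)).
pose Z : {linear V -> R} := HB.pack z (GRing.isLinear.Build _ _ _ _ z lz).
by rewrite -[z (- v)]/(Z (- v)) linearN lerN2.
Qed.

End Sublinear.

(** The dominated extension theorem; the subspace is given by a linear map [i],
    which need not be injective. *)
Corollary Hahn_Banach (R : realType) (V N : lmodType R) (i : {linear N -> V})
    (psi : {linear N -> R}) (p : V -> R) : sublinear p ->
  (forall n, psi n <= p (i n)) ->
  exists z : V -> R,
    [/\ linear z, forall x, z x <= p x & forall n, z (i n) = psi n].
Proof.
move=> sp psip.
pose C := [set c | exists n, c = (- i n, psi n)].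
have pC : dominating_cone p C.
  split.
  - by exists 0; rewrite (linear0 i) (linear0 psi) oppr0.
  - by move=> _ _ [n ->] [m ->]; exists (n + m);
    rewrite (linearD i) (linearD psi) opprD.
  - by move=> t _ t0 [n ->]; exists (t *: n);
    rewrite (linearZ_LR i) (linearZ_LR psi) -scalerN.
  - move=> _ [n ->] /=; have := psip (- n).
    by rewrite !linearN; lra.
have [z lz zp] := linear_minorant (sublinear_cone_inf sp pC).
exists z; split => // [x|n].
  by rewrite (le_trans (zp x))// cone_inf_le_self.
have z_le m : z (i m) <= psi m.
  have Cm : C (- i m, psi m) by exists m.
  have := le_trans (zp _) (cone_infN sp pC Cm).
  by rewrite opprK.
pose Z : {linear V -> R} := HB.pack z (GRing.isLinear.Build _ _ _ _ z lz).
apply/eqP; rewrite eq_le z_le/=; have := z_le (- n).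
by rewrite -[z _]/(Z _) !linearN lerN2.
Qed.

Lemma sublinearZ (R : realType) (V : lmodType R) (q : V -> R) (k : R) :
  0 <= k -> sublinear q -> sublinear (fun x => k * q x).
Proof.
move=> k0 [qD qZ]; split=> [x y|t x t0]; first by rewrite -mulrDr ler_wpM2l.
by rewrite mulrCA ler_wpM2l// qZ.
Qed.

Section infconv.
Context {R : realType} {V : lmodType R}.
Implicit Types f g : V -> R.

(** The infimal convolution: the infimum of [f u + g v] over [u + v = w], that
    is, the lowering of [g] along the reflected epigraph of [f]. *)
Definition infconv f g : V -> R := cone_inf g [set c | f (- c.1) <= c.2].

Variables f g : V -> R.
Hypotheses (f_sublinear : sublinear f) (g_sublinear : sublinear g).
Hypothesis fg_ge0 : forall u, 0 <= f (- u) + g u.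

Let fg_cone : dominating_cone g [set c | f (- c.1) <= c.2].
Proof.
split=> [|c d fc fd|t c t0 fc|c fc] /=.
- by rewrite oppr0 sublinear0.
- by rewrite opprD (le_trans (f_sublinear.1 _ _))// lerD.
- by rewrite -scalerN (le_trans (f_sublinear.2 _ _ t0))// ler_wpM2l.
- by rewrite (le_trans (fg_ge0 c.1))// addrC lerD2l.
Qed.

Lemma sublinear_infconv : sublinear (infconv f g).
Proof. exact: sublinear_cone_inf. Qed.

Lemma infconv_le u v : infconv f g (u + v) <= f u + g v.
Proof.
have Cu : [set c : V * R | f (- c.1) <= c.2] (- u, f u) by rewrite /= opprK.
have := cone_inf_le g_sublinear fg_cone (u + v) Cu.
by rewrite /= [g _ + _]addrC addrAC subrr add0r.
Qed.

Lemma infconv_lel u : infconv f g u <= f u.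
Proof. by have := infconv_le u 0; rewrite (sublinear0 g_sublinear) !addr0. Qed.

Lemma infconv_ler v : infconv f g v <= g v.
Proof. exact: cone_inf_le_self. Qed.

Lemma infconv_ge w k : (forall u, k <= f u + g (w - u)) -> k <= infconv f g w.
Proof.
move=> kfg; apply: (cone_inf_ge fg_cone) => c fc.
apply: le_trans (kfg (- c.1)) _.
by rewrite opprK addrC lerD2l.
Qed.

Lemma infconv_adherent w k : infconv f g w < k ->
  exists u, f u + g (w - u) < k.
Proof.
move=> wk; apply/not_existsP => H; move: wk; apply/negP; rewrite -leNgt.
by apply: infconv_ge => u; rewrite leNgt; exact/negP.
Qed.

End infconv.

(** * Functionals on normed spaces *)

Lemma sublinear_norm (R : realType) (V : normedModType R) :
  sublinear (fun v : V => `|v|).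
Proof. by split=> [x y|t x t0]; rewrite ?ler_normD// normrZ ger0_norm. Qed.

Lemma sublinear_normD (R : realType) (V : normedModType R) (z : dual V) :
  sublinear (fun v => `|v| + z v).
Proof.
split=> [x y|t x t0]; first by rewrite linearD addrACA lerD2r ler_normD.
by rewrite normrZ ger0_norm// linearZ/= mulrDr.
Qed.

Lemma dual_norm_ler_one_sided (R : realType) (V : normedModType R)
    (y : dual V) (k : R) :
  0 <= k -> (forall v, y v <= k * `|v|) -> `|y| <= k.
Proof.
move=> k0 yk; apply: dual_norm_ler => // v; rewrite ler_norml yk andbT.
by have := yk (- v); rewrite linearN normrN; lra.
Qed.

Lemma dual_ler_norm (R : realType) (V : normedModType R)
    (y : dual V) (k : R) v :
  `|y| <= k -> y v <= k * `|v|.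
Proof.
move=> yk; apply: le_trans (ler_norm _) (le_trans (ler_dual_norm y v) _).
exact: ler_wpM2r.
Qed.

Section dominated_by_norm.
Context {R : realType} {V : normedModType R}.

Lemma sublinear_scaled_norm (k : R) : 0 <= k ->
  sublinear (fun v : V => k * `|v|).
Proof. by move=> k0; apply: sublinearZ => //; exact: sublinear_norm. Qed.

Lemma linear_le_norm (z : V -> R) (k : R) : linear z ->
  (forall v, z v <= k * `|v|) -> forall v, `|z v| <= k * `|v|.
Proof.
move=> lz zk v; rewrite ler_norml zk andbT lerNl -normrN.
pose Z : {linear V -> R} := HB.pack z (GRing.isLinear.Build _ _ _ _ z lz).
by rewrite -[z v]/(Z v) -linearN; exact: zk.
Qed.

End dominated_by_norm.

Lemma closed_subspace_separation (R : realType) (V : completeNormedModType R)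
    (M : set V) (v : V) : closed_subspace M -> ~ M v ->
  exists z : dual V, (forall m, M m -> z m = 0) /\ z v != 0.
Proof.
move=> [M0 MD Mc] Mv.
have MN m : M m -> M (- m).
  by move=> Mm; rewrite -scaleN1r -[_ *: _]addr0; exact: MD.
(* Lowering the norm along [M] gives the distance to [M]. *)
pose q (u : V) := 1 * `|u|.
have q_sub : sublinear q by exact: sublinear_scaled_norm.
pose C := [set c : V * R | M c.1 /\ c.2 = 0].
have qC : dominating_cone q C.
  split=> [//|c d [c1 c2] [d1 d2]|t c _ [c1 c2]|c [_ c2]].
  - split; first by have := MD 1 _ _ c1 d1; rewrite scale1r.
    by rewrite /= c2 d2 addr0.
  - split; first by rewrite -[_ *: _]addr0; exact: MD.
    by rewrite /= c2 mulr0.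
  - by rewrite c2 addr0 /q mul1r.
have [z [lz zq zv]] := linear_minorant_at v (sublinear_cone_inf q_sub qC).
have z1 u : z u <= 1 * `|u|.
  by rewrite (le_trans (zq u))//; exact: cone_inf_le_self.
exists (Dual (dual_mk_subproof lz (linear_le_norm lz z1))); split=> [m Mm /=|/=].
  have z_le u : M u -> z u <= 0.
    move=> /MN Mu; apply: le_trans (zq u) _.
    have Cu : C (- u, 0) by [].
    by have := cone_infN q_sub qC Cu; rewrite opprK.
  pose Z : {linear V -> R} := HB.pack z (GRing.isLinear.Build _ _ _ _ z lz).
  apply/eqP; rewrite eq_le z_le//=; have := z_le _ (MN _ Mm).
  by rewrite -[z _]/(Z _) linearN oppr_le0.
rewrite zv gt_eqF//.
have : nbhs v (~` M) by apply: open_nbhs_nbhs; split=> //; exact: closed_openC.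
move=> /nbhs_ballP[eps /= eps0 epsM]; apply: lt_le_trans eps0 _.
apply: (cone_inf_ge qC) => -[c _] [/= Mc' ->].
rewrite addr0 /q mul1r leNgt; apply/negP => vc.
have : ball v eps (- c) by rewrite -ball_normE/= opprK.
by move=> /epsM; apply; exact: MN.
Qed.

(** * Intermediate points in complete convex metric spaces *)

Section Menger.
Context {R : realType} {X : metricType R}.

(** [t.1] and [t.2] lie, in this order, on a segment from [s.1] to [s.2].  The
    reverse inequality is the triangle inequality. *)
Definition segment_refines (s t : X * X) : Prop :=
  mdist s.1 t.1 + mdist t.1 t.2 + mdist t.2 s.2 <= mdist s.1 s.2.

Lemma segment_refines_refl s : segment_refines s s.
Proof. by rewrite /segment_refines !mdistxx add0r addr0. Qed.

Lemma segment_refines_trans s t u :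
  segment_refines s t -> segment_refines t u -> segment_refines s u.
Proof.
rewrite /segment_refines.
have := metric_triangle s.1 t.1 u.1; have := metric_triangle u.2 t.2 s.2.
lra.
Qed.

Lemma segment_refines_anti s t :
  segment_refines s t -> segment_refines t s -> s = t.
Proof.
case: s t => [a b] [c d]; rewrite /segment_refines/= => st ts.
have := mdist_ge0 a c; have := mdist_ge0 c a.
have := mdist_ge0 b d; have := mdist_ge0 d b => *.
by congr pair; apply: mdist_positivity; lra.
Qed.

Let near_fst (F : set_system (X * X)) (t : X * X) eps :
  ProperFilter F -> F --> t -> 0 < eps -> F [set u | mdist t.1 u.1 < eps].
Proof.
move=> FF Ft eps0; apply: (Ft [set u | mdist t.1 u.1 < eps]).
exists (ball t.1 eps, setT); first by split; [exact: nbhsx_ballx|exact: filterT].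
by move=> u [/=]; rewrite ballEmdist.
Qed.

Let near_snd (F : set_system (X * X)) (t : X * X) eps :
  ProperFilter F -> F --> t -> 0 < eps -> F [set u | mdist t.2 u.2 < eps].
Proof.
move=> FF Ft eps0; apply: (Ft [set u | mdist t.2 u.2 < eps]).
exists (setT, ball t.2 eps); first by split; [exact: filterT|exact: nbhsx_ballx].
by move=> u [/=]; rewrite ballEmdist.
Qed.

Lemma segment_refines_lim (F : set_system (X * X)) (s t : X * X) :
  ProperFilter F -> F --> t -> F [set u | segment_refines s u] ->
  segment_refines s t.
Proof.
move=> FF Ft Fs; apply/ler_addgt0Pl => eps eps0.
have eps4 : 0 < eps / 4 by rewrite divr_gt0.
have F1 : F [set u | mdist t.1 u.1 < eps / 4].
  exact: near_fst.
have F2 : F [set u | mdist t.2 u.2 < eps / 4].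
  exact: near_snd.
have [u [[u1 u2] su]] := filter_ex (filterI (filterI F1 F2) Fs).
move: u1 u2 su; rewrite /segment_refines/=.
have := metric_triangle s.1 u.1 t.1; have := metric_triangle t.1 u.1 t.2.
have := metric_triangle u.1 u.2 t.2; have := metric_triangle t.2 u.2 s.2.
rewrite (metric_sym u.1 t.1) (metric_sym u.2 t.2).
lra.
Qed.

Hypotheses (X_complete : metric_complete X) (X_convex : metric_convex X).

(** Along a chain the lengths decrease, so the end points converge. *)
Lemma chain_segment_lim (A : set (X * X)) : A !=set0 ->
  (forall s t, A s -> A t -> segment_refines s t \/ segment_refines t s) ->
  exists F : set_system (X * X), exists t : X * X, [/\ ProperFilter F, F --> t &
    forall s, A s -> F [set u | A u /\ segment_refines s u]].
Proof.
move=> [s0 As0] totA.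
pose up s := [set u | A u /\ segment_refines s u].
pose F := filter_from A up.
have FF : ProperFilter F.
  apply: filter_from_proper; last first.
    by move=> s As; exists s; split=> //; exact: segment_refines_refl.
  apply: filter_from_filter; first by exists s0.
  move=> s t As At; have [st|ts] := totA _ _ As At.
    by exists t => // u [Au tu]; split; split=> //; exact: segment_refines_trans tu.
  by exists s => // u [Au tu]; split; split=> //; exact: segment_refines_trans tu.
have Fup s : A s -> F (up s) by move=> As; exists s.
have small eps : 0 < eps -> exists2 s, A s & forall u, up s u ->
    mdist s.1 u.1 < eps /\ mdist s.2 u.2 < eps.
  move=> eps0; pose L := [set mdist s.1 s.2 | s in A].
  have iL : has_inf L.
    split; first by exists (mdist s0.1 s0.2), s0.
    by exists 0 => _ [s _ <-]; exact: mdist_ge0.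
  have [_ [s As <-] s_lt] := inf_adherent eps0 iL.
  exists s => // u [Au]; rewrite /segment_refines (metric_sym u.2) => su.
  have u_ge : inf L <= mdist u.1 u.2.
    by apply: ge_inf; [exact: iL.2|exists u].
  have := mdist_ge0 s.1 u.1; have := mdist_ge0 s.2 u.2.
  by split; lra.
have c1 : cauchy (fst @ F).
  apply: cauchy_exP => eps /small[s As su]; exists s.1; exists s => // u /su[+ _].
  by rewrite ballEmdist.
have c2 : cauchy (snd @ F).
  apply: cauchy_exP => eps /small[s As su]; exists s.2; exists s => // u /su[_].
  by rewrite ballEmdist.
have [x Fx] := X_complete (fmap_proper_filter fst FF) c1.
have [y Fy] := X_complete (fmap_proper_filter snd FF) c2.
exists F, (x, y); split => //.
have pairE : (fun u : X * X => (u.1, u.2)) = id by apply/funext => -[].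
have := cvg_pair Fx Fy; rewrite pairE; exact.
Qed.

(** Menger's theorem.  A maximal refinement of [(p, q)] whose end points
    straddle the distance [t] from [p] is reduced to a point, since otherwise
    convexity would refine it further. *)
Theorem metric_between (p q : X) (t : R) : 0 <= t -> t <= mdist p q ->
  exists r, mdist p r = t /\ mdist r q = mdist p q - t.
Proof.
move=> t0 tpq.
pose ok (s : X * X) := [/\ segment_refines (p, q) s, mdist p s.1 <= t &
  mdist s.2 q <= mdist p q - t].
pose refb (s u : {s | ok s}) := `[< segment_refines (sval s) (sval u) >].
have [|s u v|s u|A totA|[[a b] abok] abmax] := @Zorn {s | ok s} refb.
- by move=> s; apply/asboolP; exact: segment_refines_refl.
- by move=> /asboolP su /asboolP uv; apply/asboolP; exact: segment_refines_trans uv.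
- move: s u => [s sP] [u uP] /asboolP/= su /asboolP/= us.
  by apply: eq_exist; exact: segment_refines_anti.
- have [->|/set0P[s0 As0]] := eqVneq A set0.
    have pqok : ok (p, q).
      split; [exact: segment_refines_refl|by rewrite mdistxx|].
      by rewrite mdistxx subr_ge0.
    by exists (exist _ _ pqok).
  pose B := [set sval s | s in A].
  have [|_ _ [s As <-] [u Au <-]|F [u [FF Fu Fup]]] := @chain_segment_lim B.
  + by exists (sval s0), s0.
  + by have [/asboolP|/asboolP] := totA _ _ As Au; [left|right].
  + have B_lim s : A s -> segment_refines (sval s) u.
      move=> As; apply: (segment_refines_lim FF Fu).
      by apply: filterS (Fup (sval s) _) => [v []//|]; exists s.
    have uok : ok u.
      have [sp1 sp2 sp3] := svalP s0; have su := B_lim _ As0.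
      have Fok : F ok.
        apply: filterS (Fup (sval s0) _) => [v [[w Aw <-] _]|]; last by exists s0.
        exact: svalP w.
      split; first exact: segment_refines_trans su.
        apply/ler_addgt0Pl => eps eps0.
        have F1 : F [set v | mdist u.1 v.1 < eps].
          exact: near_fst.
        have [v [/= uv [_ v1 _]]] := filter_ex (filterI F1 Fok).
        by have := metric_triangle p v.1 u.1; rewrite (metric_sym v.1); lra.
      apply/ler_addgt0Pl => eps eps0.
      have F2 : F [set v | mdist u.2 v.2 < eps].
        exact: near_snd.
      have [v [/= uv [_ _ v2]]] := filter_ex (filterI F2 Fok).
      by have := metric_triangle u.2 v.2 q; lra.
    by exists (exist _ u uok) => s As; apply/asboolP; exact: B_lim.
have [ab_pq pa bq] := abok; rewrite /segment_refines/= in ab_pq pa bq.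
have ab : a = b.
  apply: contrapT => ab; have [r [ra rb abr]] := X_convex ab.
  (* [r] replaces [a] or [b], according to its distance from [p]. *)
  have [rt|tr] := leP (mdist p r) t.
    have rbok : ok (r, b).
      split=> //; rewrite /segment_refines/=.
      by have := metric_triangle p a r; lra.
    apply: ra; apply: (congr1 (fun s : {s | ok s} => (sval s).1)
      (abmax (exist _ _ rbok) _)).
    by apply/asboolP; rewrite /segment_refines/= mdistxx; lra.
  have arok : ok (a, r).
    rewrite /ok /segment_refines/=; split=> //.
      by have := metric_triangle r b q; lra.
    have := metric_triangle r b q; have := metric_triangle p a r; lra.
  apply: rb; apply: (congr1 (fun s : {s | ok s} => (sval s).2)
    (abmax (exist _ _ arok) _)).
  by apply/asboolP; rewrite /segment_refines/= mdistxx; lra.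
exists a; move: bq; rewrite -ab => aq.
by have := metric_triangle p a q; split; apply/eqP; rewrite eq_le; lra.
Qed.

End Menger.

(** * Intersections of two opposite unit balls *)

Section lens.
Context {R : realType} {W : completeNormedModType R}.

(** The intersection of the closed unit balls centred at [- a] and [a]. *)
Definition lens (E : normedModType R) (a : E) : set E :=
  [set y | `|y + a| <= 1 /\ `|y - a| <= 1].

Variable a : dual W.
Hypothesis a_le1 : `|a| <= 1.
(** This holds when the lens is the unit ball of a subspace. *)
Hypothesis lens_scale : forall (c : R) (y : dual W),
  0 < c -> lens a y -> `|c *: y| <= 1 -> lens a (c *: y).

(** The support function of the lens, by [lensP] and the Hahn-Banach theorem. *)
Let p : W -> R := infconv (fun v => `|v| + (- a) v) (fun v => `|v| + a v).

Let p_cond (u : W) : 0 <= `|- u| + (- a) (- u) + (`|u| + a u).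
Proof.
have aN : a (- u) = - a u by rewrite linearN.
have := @dual_ler_norm _ _ a 1 (- u) a_le1.
rewrite dualNE aN opprK normrN mul1r.
lra.
Qed.

Let p_sublinear : sublinear p.
Proof. exact: sublinear_infconv (sublinear_normD _) (sublinear_normD _) p_cond. Qed.

Let lensP (y : dual W) : lens a y <-> forall w, y w <= p w.
Proof.
split=> [[ya yNa] w|yp].
  apply: (infconv_ge (sublinear_normD _) p_cond) => u.
  have yE : y w = y u + y (w - u) by rewrite -linearD addrC subrK.
  have := dual_ler_norm u ya; have := dual_ler_norm (w - u) yNa.
  by rewrite !dualDE !dualNE !mul1r yE; lra.
split; apply: dual_norm_ler_one_sided => // w; rewrite mul1r dualDE -?dualNE.
  apply: (@le_trans _ _ (p w + a w)); first by rewrite lerD2r.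
  have := infconv_lel (sublinear_normD _) (sublinear_normD _) p_cond w.
  by rewrite -/p dualNE; lra.
apply: (@le_trans _ _ (p w + (- a) w)); first by rewrite lerD2r.
have := infconv_ler (sublinear_normD _) (sublinear_normD _) p_cond w.
by rewrite -/p dualNE; lra.
Qed.

Let lens0 : lens a 0.
Proof. by split; rewrite add0r ?normrN. Qed.

Let lensN y : lens a y -> lens a (- y).
Proof.
move=> [ya yNa]; split; last by rewrite -opprD normrN.
by rewrite -normrN opprD opprK.
Qed.

Let p_ge0 w : 0 <= p w.
Proof. by have /lensP := lens0; exact. Qed.

(** Lower [2 p] to its infimal convolution [q] with the norm.  A linear
    functional below [q] is of norm at most 1 and is twice an element of the
    lens, so it lies in the lens; hence [q <= p]. *)
Let split_half w d : p w < d -> exists u, `|u| < d /\ p (w - u) < d / 2.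
Proof.
move=> wd.
have f_sub : sublinear (fun v : W => `|v|).
  exact: sublinear_norm.
have g_sub : sublinear (fun v => 2 * p v) by exact: sublinearZ.
have fg u : 0 <= `|- u| + 2 * p u by rewrite addr_ge0// mulr_ge0.
pose q := infconv (fun v : W => `|v|) (fun v => 2 * p v).
have [z [lz zq zw]] : exists z : W -> R,
    [/\ linear z, forall x, z x <= q x & z w = q w].
  exact/linear_minorant_at/sublinear_infconv.
have z1 v : z v <= 1 * `|v|.
  by rewrite (le_trans (zq v))// mul1r; exact: infconv_lel f_sub g_sub fg v.
have zp v : z v <= 2 * p v.
  by rewrite (le_trans (zq v))//; exact: infconv_ler f_sub g_sub fg v.
have zb v : `|z v| <= 1 * `|v|.
  rewrite ler_norml z1 andbT -normrN.
  pose Z : {linear W -> R} := HB.pack z (GRing.isLinear.Build _ _ _ _ z lz).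
  by rewrite lerNl -[z v]/(Z v) -linearN; exact: z1.
pose y := Dual (dual_mk_subproof lz zb).
have y2 : lens a (2^-1 *: y).
  by apply/lensP => v; rewrite dualZE ler_pdivrMl//; exact: zp.
have y_lens : lens a y.
  have := @lens_scale 2 (2^-1 *: y) (ltr0n _ 2) y2.
  have -> : 2 *: (2^-1 *: y) = y.
    by apply: dualP => v; rewrite !dualZE mulVKf// pnatr_eq0.
  apply.
  exact: (@dual_norm_ler _ _ y 1 ler01 zb).
have qd : q w < d by rewrite -zw; apply: le_lt_trans wd;
  exact: ((lensP y).1 y_lens w).
have [u] := infconv_adherent f_sub fg qd.
move=> uwd; exists u.
by have := p_ge0 (w - u); have := normr_ge0 u; split; lra.
Qed.

(** Iterating [split_half] and summing a geometric series of norms. *)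
Let near_preannihilator w d : p w < d -> exists2 n,
  forall y, lens a y -> y n = 0 & `|w - n| <= 2 * d.
Proof.
move=> wd.
have /choice[st stP] : forall vd : W * R, exists u : W, p vd.1 < vd.2 ->
    `|u| < vd.2 /\ p (vd.1 - u) < vd.2 / 2.
  move=> [v e] /=.
  have [/split_half[u uP]|ve] := ltP (p v) e; first by exists u.
  by exists 0.
(* The pairs of the current remainder and of the bound on [p] there. *)
pose next vd : W * R := (vd.1 - st vd, vd.2 / 2).
pose s k := iter k next (w, d).
have sP k : p (s k).1 < (s k).2.
  by elim: k => [//|k IH]; exact: (stP (s k) IH).2.
have s_gt0 k : 0 < (s k).2 by exact: le_lt_trans (p_ge0 _) (sP k).
have s_step k m :
    `|(s k).1 - (s (m + k)%N).1| <= 2 * ((s k).2 - (s (m + k)%N).2).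
  elim: m => [|m IH]; first by rewrite !subrr normr0 mulr0.
  have [st_lt _] := stP _ (sP (m + k)%N).
  have -> : (s (m.+1 + k)%N) = next (s (m + k)%N) by [].
  rewrite /= opprB addrCA addrC.
  have := ler_normD ((s k).1 - (s (m + k)%N).1) (st (s (m + k)%N)).
  by move: IH st_lt; lra.
have s_dist k m : (k <= m)%N -> `|(s k).1 - (s m).1| <= 2 * (s k).2.
  move=> /subnK <-; apply: le_trans (s_step _ _) _.
  by have := s_gt0 (m - k + k)%N; lra.
have s2E k : (s k).2 = geometric d 2^-1 k.
  rewrite /geometric/=; elim: k => [|k IH]; first by rewrite expr0 mulr1.
  by rewrite exprS mulrCA mulrC -IH.
have s2_cvg : (fun k => (s k).2) @ \oo --> (0 : R).
  under eq_fun do rewrite s2E.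
  by apply: cvg_geometric; rewrite ger0_norm ?invr_ge0// invf_lt1// ltr1n.
have s2_small eps : 0 < eps -> exists k, (s k).2 < eps.
  move=> eps0; have /cvgrPdist_lt/(_ _ eps0)[k _ /(_ k (leqnn _))] := s2_cvg.
  by rewrite sub0r normrN => /(le_lt_trans (ler_norm _)) ?; exists k.
have : cvg ((fun k => (s k).1) @ \oo).
  apply: cauchy_cvg; apply: cauchy_exP => eps eps0.
  have [|k keps] := s2_small (eps / 2); first by rewrite divr_gt0.
  exists (s k).1; exists k => // m /= km; rewrite -ball_normE/=.
  by have := s_dist _ _ km; lra.
move=> /cvg_ex[n s_n].
have s_dist_n k : `|(s k).1 - n| <= 2 * (s k).2.
  apply/ler_addgt0Pl => eps eps0.
  have /cvgrPdist_lt/(_ _ eps0)[m _ mP] := s_n.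
  have := mP (maxn m k) (leq_maxl _ _); have := s_dist _ _ (leq_maxr m k).
  rewrite (distrC n) /=.
  have := ler_normD ((s k).1 - (s (maxn m k)).1) ((s (maxn m k)).1 - n).
  by rewrite addrA subrK; lra.
exists n; last exact: (s_dist_n 0%N).
move=> y ya; apply/eqP; rewrite -normr_le0; apply/ler_addgt0Pl => eps eps0.
have y0 : 0 < 2 * `|y| + 1 by rewrite ltr_wpDl// mulr_ge0.
have [|k keps] := s2_small (eps / (2 * `|y| + 1)); first by rewrite divr_gt0.
move: keps; rewrite ltr_pdivlMr// addr0 => keps.
have y_k : `|y (s k).1| <= (s k).2.
  have /lensP/(_ (s k).1) y1 := ya; have /lensP/(_ (s k).1) := lensN ya.
  by rewrite dualNE ler_norml => y2; have := sP k; lra.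
have := le_trans (ler_dual_norm y _) (ler_wpM2l (normr_ge0 y) (s_dist_n k)).
have := ler_normB (y (s k).1) (y ((s k).1 - n)).
rewrite {1}linearB subKr.
by move: y_k keps; lra.
Qed.

(** The annihilator of the pre-annihilator of the lens is its linear span. *)
Theorem lens_annihilator (z : dual W) :
  (forall n, (forall y, lens a y -> y n = 0) -> z n = 0) ->
  exists c : R, exists2 y, lens a y & z = c *: y.
Proof.
move=> z0; pose c := 2 * `|z| + 1.
have c0 : 0 < c by rewrite ltr_wpDl// mulr_ge0.
exists c, (c^-1 *: z); last by rewrite scalerKV// gt_eqF.
apply/lensP => w; rewrite dualZE ler_pdivrMl//.
suff zd d : p w < d -> z w <= 2 * `|z| * d.
  apply/ler_addgt0Pl => eps eps0.
  have d0 : p w < p w + eps / c by rewrite ltrDl divr_gt0.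
  rewrite (le_trans (zd _ d0))// (@le_trans _ _ (c * (p w + eps / c)))//.
    by rewrite ler_wpM2r ?lerDl// addr_ge0// ltW// divr_gt0.
  by rewrite mulrDr mulrC [c * (_ / c)]mulrC divfK ?gt_eqF// addrC mulrC.
move=> /near_preannihilator[n n0 wn].
have -> : z w = z (w - n) + z n by rewrite -linearD subrK.
rewrite (z0 n n0) addr0.
rewrite (le_trans (dual_ler_norm _ (lexx _)))//.
by rewrite -mulrA mulrCA ler_wpM2l.
Qed.

End lens.

(** * Restriction, extension and functions vanishing on a ball *)

Section Lip0_norm.
Context {R : realType} {X : metricType R} (e : X).
Implicit Types f : Lip0 e.

Lemma Lip0_norm_le f (k : R) : 0 <= k ->
  (forall p q, `|f p - f q| <= k * mdist p q) -> `|f| <= k.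
Proof. exact: lip_number_le. Qed.

Lemma Lip0_ler_norm f (k : R) p q : `|f| <= k ->
  `|f p - f q| <= k * mdist p q.
Proof.
move=> fk; apply: le_trans (lipschitz_le p q (Lip0_lipschitz f)) _.
by rewrite ler_wpM2r// mdist_ge0.
Qed.

End Lip0_norm.

Section restriction.
Context {R : realType} {X : metricType R} (e : X) (n : nat).
Let en := cball_center e n : cball e (n%:R : R).

Fact Lip0_restr_subproof (f : Lip0 e) :
  (fun x : cball e (n%:R : R) => f (val x)) \in Lip0_pred en.
Proof.
apply/asboolP; split; last exact: Lip0_base.
apply: (@lipschitz_mk _ _ _ `|f|) => p q.
exact: Lip0_ler_norm.
Qed.

(** Restriction to the closed ball of radius [n]. *)
Definition Lip0_restr (f : Lip0 e) : Lip0 en := MkLip0 (Lip0_restr_subproof f).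

Lemma Lip0_restr_norm f : `|Lip0_restr f| <= `|f|.
Proof.
apply: Lip0_norm_le => // p q.
exact: (Lip0_ler_norm (val p) (val q) (lexx `|f|)).
Qed.

(** McShane's extension, the infimum over [y] of [h y + |h| d(y, x)]. *)
Theorem McShane (h : Lip0 en) : exists f, Lip0_restr f = h /\ `|f| <= `|h|.
Proof.
pose S x := [set h y + `|h| * mdist (val y) x | y in [set: cball e (n%:R : R)]].
have S_lb x y z : h z - `|h| * mdist (val z) x <= h y + `|h| * mdist (val y) x.
  have := ler_norm (h z - h y); have := Lip0_ler_norm z y (lexx `|h|).
  have := ler_wpM2l (normr_ge0 h) (metric_triangle (val z) x (val y)).
  by rewrite mulrDr cball_mdistE (metric_sym x); lra.
pose F x := inf (S x).
have F_le x y : F x <= h y + `|h| * mdist (val y) x.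
  apply: ge_inf; last by exists y.
  by exists (h en - `|h| * mdist (val en) x) => _ [z _ <-].
have F_ge x k : (forall y, k <= h y + `|h| * mdist (val y) x) -> k <= F x.
  move=> kh; apply: lb_le_inf => [|_ [y _ <-]]; last exact: kh.
  by exists (h en + `|h| * mdist (val en) x), en.
have F_val y : F (val y) = h y.
  apply/eqP; rewrite eq_le; apply/andP; split.
    by rewrite (le_trans (F_le _ y))// mdistxx mulr0 addr0.
  apply: F_ge => z; have := S_lb (val y) z y.
  by rewrite mdistxx mulr0 subr0.
have F_lip p q : `|F p - F q| <= `|h| * mdist p q.
  wlog pq : p q / F q <= F p.
    move=> H; have [/H//|/ltW/H] := leP (F q) (F p).
    by rewrite distrC metric_sym.
  rewrite ger0_norm ?subr_ge0// lerBlDr -lerBlDl; apply: F_ge => y.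
  rewrite lerBlDl; apply: le_trans (F_le p y) _.
  have := ler_wpM2l (normr_ge0 h) (metric_triangle (val y) q p).
  by rewrite mulrDr (metric_sym q p); lra.
have FP : F \in Lip0_pred e.
  apply/asboolP; split; first exact: lipschitz_mk F_lip.
  by have := F_val en; rewrite Lip0_base.
exists (MkLip0 FP); split; last first.
  exact: (@Lip0_norm_le _ _ _ (MkLip0 FP) _ (normr_ge0 h) F_lip).
by apply: Lip0P => y; exact: F_val.
Qed.

End restriction.

Section peak.
Context {R : realType} {X : metricType R} (e : X) (r : R).
Hypothesis r_ge0 : 0 <= r.

Let bump (x : X) : R := Num.max 0 (Num.min (mdist e x) (r - mdist e x)).

Let bump_lip p q : `|bump p - bump q| <= 1 * mdist p q.
Proof.
have := metric_triangle e p q; have := metric_triangle e q p.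
rewrite (metric_sym q p) mul1r /bump ler_norml.
have := mdist_ge0 p q.
set d := mdist p q; set a := mdist e p; set b := mdist e q => *.
by case: (leP a) => ?; case: (leP b) => ?;
  case: (leP 0) => ?; case: (leP 0) => ?; lra.
Qed.

Fact peak_subproof : bump \in Lip0_pred e.
Proof.
apply/asboolP; split; first exact: lipschitz_mk bump_lip.
by rewrite /bump mdistxx subr0 min_l// maxxx.
Qed.

(** The function of the distance to [e] that rises with slope 1 up to distance
    [r / 2], descends with slope -1 to 0 at distance [r], and is 0 beyond. *)
Definition peak : Lip0 e := MkLip0 peak_subproof.

Lemma peakE x : peak x = Num.max 0 (Num.min (mdist e x) (r - mdist e x)).
Proof. by []. Qed.

Lemma peak_norm : `|peak| <= 1.
Proof. exact: (@Lip0_norm_le _ _ _ peak _ ler01 bump_lip). Qed.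

Hypotheses (X_complete : metric_complete X) (X_convex : metric_convex X).

(** The segment from [q] to [e] meets the sphere of radius [r]. *)
Let ball_dist (f : Lip0 e) (k : R) q : `|f| <= k -> r <= mdist e q ->
  (forall x, mdist e x <= r -> f x = 0) -> `|f q| <= k * (mdist e q - r).
Proof.
move=> fk rq f0; have [x [ex <-]] := metric_between X_complete X_convex r_ge0 rq.
rewrite -[f q]subr0 -(f0 x) ?ex// distrC.
exact: Lip0_ler_norm.
Qed.

(** Inside the ball only the peak contributes, outside only [f], and across the
    sphere the two contributions are bounded by the differences of radii. *)
Let peak_sum (s : R) (f : Lip0 e) : `|s| = 1 -> `|f| <= 1 ->
  (forall x, mdist e x <= r -> f x = 0) -> `|f + s *: peak| <= 1.
Proof.
move=> s1 f1 f0; apply: Lip0_norm_le => // p q.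
wlog pq : p q / mdist e p <= mdist e q.
  move=> H; have [/H//|/ltW/H] := leP (mdist e p) (mdist e q).
  by rewrite distrC metric_sym.
rewrite !Lip0DE !Lip0ZE.
have E : f p + s * peak p - (f q + s * peak q) =
  (f p - f q) + s * (peak p - peak q) by ring.
have [qr|/ltW rq] := leP (mdist e q) r.
  rewrite E !f0 ?(le_trans pq)// subrr add0r normrM s1 mul1r.
  exact: Lip0_ler_norm peak_norm.
have peak0 x : r <= mdist e x -> peak x = 0.
  move=> rx; rewrite peakE max_l// ge_min; apply/orP; right; lra.
have [pr|/ltW rp] := leP (mdist e p) r; last first.
  by rewrite E !peak0// subrr mulr0 addr0; exact: Lip0_ler_norm.
rewrite (f0 p pr) (peak0 q rq) mulr0 addr0 add0r.
have := ler_normB (s * peak p) (f q); rewrite normrM s1 mul1r.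
have := ball_dist f1 rq f0.
have : `|peak p| <= r - mdist e p.
  rewrite ger0_norm peakE ?le_max ?lexx// ge_max subr_ge0 pr/=.
  by rewrite ge_min lexx orbT.
by have := metric_triangle e p q; lra.
Qed.

(** The unit ball of the space of functions vanishing on the ball of radius
    [r].  If [f] lies in the lens then [|f p - f q| + |peak p - peak q|] is at
    most the distance of [p] and [q], so [f] is constant along the segments on
    which the slope of the peak is 1 in absolute value. *)
Theorem lens_peak (f : Lip0 e) : lens peak f <->
  `|f| <= 1 /\ forall x, mdist e x <= r -> f x = 0.
Proof.
split=> [[fp fNp]|[f1 f0]]; last first.
  have := @peak_sum 1 f (normr1 _) f1 f0; have := @peak_sum (-1) f _ f1 f0.
  by rewrite normrN1 scaleN1r scale1r => /(_ erefl).
have f_sum p q : `|f p - f q| + `|peak p - peak q| <= mdist p q.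
  have := Lip0_ler_norm p q fp; have := Lip0_ler_norm p q fNp.
  rewrite !Lip0DE !Lip0NE !mul1r !ler_norml => /andP[? ?] /andP[? ?].
  by case: (ger0P (f p - f q)) => ?; case: (ger0P (peak p - peak q)) => ?; lra.
split.
  apply: Lip0_norm_le => // p q; have := f_sum p q.
  by have := normr_ge0 (peak p - peak q); lra.
have f_flat p q : `|peak p - peak q| = mdist p q -> f p = f q.
  move=> pq; have := f_sum p q; rewrite pq gerDr normr_le0 subr_eq0.
  by move/eqP.
have inner x : mdist e x <= r / 2 -> f x = 0.
  move=> xr; rewrite -(Lip0_base f); apply: f_flat.
  rewrite (Lip0_base peak) subr0 (metric_sym x) peakE min_l; last lra.
  by rewrite max_r ?mdist_ge0// ger0_norm ?mdist_ge0.
move=> x xr; have [/inner//|rx] := leP (mdist e x) (r / 2).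
have r2 : 0 <= r / 2 by rewrite divr_ge0.
(* The point at distance [r / 2] on a segment from [e] to [x]. *)
have [y [ey yx]] := metric_between X_complete X_convex r2 (ltW rx).
rewrite -(inner y) ?ey//; apply: f_flat.
rewrite !peakE ey [mdist x y]metric_sym yx [Num.min (r / 2) _]min_l; last lra.
rewrite min_r; last lra.
rewrite !max_r; [|lra|lra].
by rewrite ler0_norm; lra.
Qed.

End peak.

(** * Weak* continuity and elements of the predual *)

Section weak_star.
Context {R : realType}.
Implicit Types E F : dualBanach R.

Lemma initial_cvgP (S : choiceType) (T : topologicalType) (f : S -> T)
    (G : set_system S) (s : S) : Filter G ->
  G --> (s : initial_topology f) <-> f @ G --> f s.
Proof.
move=> FG; split=> [Gs|Gfs A].
  by apply: cvg_comp Gs _; exact: initial_continuous.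
rewrite nbhsE => -[_ [[C Cop <-] Cs] CA].
by apply: filterS CA _; apply: Gfs; exact: open_nbhs_nbhs.
Qed.

Lemma weak_star_cvgP E (G : set_system E) (x : E) : Filter G ->
  G --> (x : weak_star E) <->
  forall w, (fun y => predual_iso y w) @ G --> predual_iso x w.
Proof. by move=> FG; rewrite initial_cvgP pointwise_cvgP. Qed.

(** A map pulling elements of the predual back to elements of the predual is
    weak* continuous. *)
Lemma weak_star_continuous_pred E F (T : E -> F) :
  (forall w : predual F, exists m : predual E,
    forall f, predual_iso (T f) w = predual_iso f m) ->
  weak_star_continuous T.
Proof.
move=> Tpred f; pose G := nbhs (f : weak_star E).
have FG : Filter G by exact: nbhs_filter.
apply/(weak_star_cvgP (G := T @ G)) => w; have [m Tm] := Tpred w.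
suff : (fun y => predual_iso (T y) w) @ G --> predual_iso (T f) w by [].
rewrite Tm; under eq_fun do rewrite Tm.
exact: (weak_star_cvgP (G := G) f FG).1.
Qed.

(** The subspaces annihilated by finitely many elements of the predual form a
    filter base converging weak* to 0; on one of them the functional is bounded
    by 1, hence zero. *)
Lemma weak_star_continuous_ker E F (T : E -> F) (w : predual F) : linear T ->
  weak_star_continuous T -> exists D : seq (predual E), forall f,
    (forall m, m \in D -> predual_iso f m = 0) -> predual_iso (T f) w = 0.
Proof.
move=> lT cT.
have [lE _ _] := predual_isoP E; have [lF _ _] := predual_isoP F.
pose iE : {linear E -> dual (predual E)} :=
  HB.pack (@predual_iso R E) (GRing.isLinear.Build _ _ _ _ _ lE).
pose iF : {linear F -> dual (predual F)} :=
  HB.pack (@predual_iso R F) (GRing.isLinear.Build _ _ _ _ _ lF).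
pose T' : {linear E -> F} := HB.pack T (GRing.isLinear.Build _ _ _ _ _ lT).
pose ker (D : seq (predual E)) : set E :=
  [set f | forall m, m \in D -> predual_iso f m = 0].
pose G := filter_from [set: seq (predual E)] ker.
have ker0 D : ker D 0 by move=> m _; rewrite -[predual_iso 0]/(iE 0) linear0.
have GF : ProperFilter G.
  apply: filter_from_proper => [|D _]; last by exists 0.
  apply: filter_from_filter => [|C D _ _]; first by exists [::].
  by exists (C ++ D) => // f fCD; split=> m mD; apply: fCD;
    rewrite mem_cat mD ?orbT.
have G0 : G --> (0 : weak_star E).
  apply/weak_star_cvgP => m; rewrite -[predual_iso 0]/(iE 0) linear0 dual0E.
  apply: cvg_near_cst; exists [:: m] => // f; apply; exact: mem_head.
have : (fun f => predual_iso (T f) w) @ G --> predual_iso (T 0) w.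
  have TG : T @ G --> (T 0 : weak_star F) by move=> A /(cT 0)/G0.
  exact: (weak_star_cvgP (G := T @ G) _ _).1 TG w.
rewrite -[T 0]/(T' 0) linear0 -[predual_iso 0]/(iF 0) linear0 dual0E.
move=> /cvgrPdist_lt/(_ 1 ltr01)[D _ DT]; exists D => f fD; apply/eqP.
apply: contraT => Tf0; set c := predual_iso (T f) w in Tf0.
have : ker D (c^-1 *: f).
  move=> m mD; rewrite -[predual_iso _]/(iE _) linearZ dualZE.
  by rewrite -[iE f]/(predual_iso f) fD// mulr0.
move=> /DT; rewrite /= sub0r normrN -[T _]/(T' _) linearZ.
rewrite -[predual_iso _]/(iF _) linearZ dualZE -[iF _ w]/c mulVf// normr1.
by rewrite ltxx.
Qed.

End weak_star.

Section dual_span.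
Context {R : realType} {V : normedModType R}.

(** A functional vanishing on the common kernel of finitely many others is a
    linear combination of them. *)
Lemma dual_span (M : set (dual V)) (D : seq (dual V)) (L : dual V) :
  M 0 -> (forall a u v, M u -> M v -> M (a *: u + v)) ->
  (forall m, m \in D -> M m) ->
  (forall f, (forall m, m \in D -> m f = 0) -> L f = 0) -> M L.
Proof.
move=> M0 MD; elim: D L => [|d D IH] L DM LD.
  by rewrite (_ : L = 0)//; apply: dualP => f; rewrite LD.
have DM' m : m \in D -> M m by move=> mD; apply: DM; rewrite in_cons mD orbT.
have [[f [fD df]]|nf] :=
  pselect (exists f, (forall m, m \in D -> m f = 0) /\ d f != 0).
  (* The functional [L - (L f / d f) d] vanishes at [f]. *)
  have {1}-> : L = (L f / d f) *: d + (L - (L f / d f) *: d).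
    by rewrite addrC subrK.
  apply: MD; first by apply: DM; exact: mem_head.
  apply: IH => // g gD; rewrite dualDE dualNE dualZE.
  have mE (m : dual V) : m (g - (d g / d f) *: f) = m g - d g / d f * m f.
    by rewrite linearB linearZ.
  have : L (g - (d g / d f) *: f) = 0.
    apply: LD => m; rewrite in_cons mE => /predU1P[->|mD].
      by rewrite divfK// subrr.
    by rewrite (gD m mD) (fD m mD) mulr0 subrr.
  by rewrite mE => <-; congr (_ - _); rewrite mulrAC [RHS]mulrAC [d g * _]mulrC.
apply: IH => // f fD; apply: LD => m; rewrite in_cons => /predU1P[->|/fD//].
by apply/eqP; apply: contrapT => /negP df; apply: nf; exists f.
Qed.

End dual_span.

Section restriction_dual.
Context {R : realType} {X : metricType R} (e : X) (n : nat).
Let en := cball_center e n : cball e (n%:R : R).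

Fact restr_dual_subproof (m : dual (Lip0 en)) :
  (fun f : Lip0 e => m (Lip0_restr n f)) \in @dual_pred R (Lip0 e).
Proof.
apply: (@dual_mk_subproof _ _ _ `|m|) => [a f g|f].
  by rewrite -dual_linear; congr (m _); exact: Lip0P.
apply: le_trans (ler_dual_norm _ _) _.
by rewrite ler_wpM2l// Lip0_restr_norm.
Qed.

(** The adjoint of the restriction map. *)
Definition restr_dual (m : dual (Lip0 en)) : dual (Lip0 e) :=
  Dual (restr_dual_subproof m).

Lemma restr_dual_norm m : `|restr_dual m| <= `|m|.
Proof.
apply: dual_norm_ler => // f; apply: le_trans (ler_dual_norm m _) _.
by rewrite ler_wpM2l// Lip0_restr_norm.
Qed.

Lemma restr_dual_arens_eells (m : dual (Lip0 en)) :
  closed_span (range (@lip_eval R _ en)) m ->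
  closed_span (range (@lip_eval R X e)) (restr_dual m).
Proof.
have [S0 SD Sc] := closed_span_closed_subspace (range (@lip_eval R X e)).
pose A := [set m | closed_span (range (@lip_eval R X e)) (restr_dual m)].
have lr : linear restr_dual by move=> a u v; exact: dualP.
pose rd : {linear dual (Lip0 en) -> dual (Lip0 e)} :=
  HB.pack restr_dual (GRing.isLinear.Build _ _ _ _ _ lr).
apply: (@smallest_sub _ closed_subspace _ A) => [|_ [p _ <-]].
  split=> [|a u v Au Av|].
  - by rewrite /A/= -[restr_dual]/(rd : _ -> _) linear0.
  - by rewrite /A/= lr; exact: SD.
  - apply: (closed_comp _ Sc) => u _.
    apply: (@bounded_linear_continuous _ _ _ rd); apply/linear_boundedP.
    near=> k => v; rewrite (le_trans (restr_dual_norm v))//.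
    by rewrite ler_peMl//; near: k; apply: nbhs_pinfty_ge; rewrite num_real.
rewrite /A/=.
have -> : restr_dual (lip_eval en p) = lip_eval e (val p) by exact: dualP.
by apply: sub_gen_smallest; exists (val p).
Unshelve. all: by end_near. Qed.

End restriction_dual.

(** * The predual transported from another dual space *)

Section transported_predual.
Context {R : realType} {X : metricType R} (e : X) (W : completeNormedModType R).
Variable S : Lip0 e -> dual W.
Hypothesis S_iso : isometric_isomorphism S.
Hypotheses (X_complete : metric_complete X) (X_convex : metric_convex X).

Let S_linear : linear S. Proof. by case: S_iso. Qed.

Let S_norm f : `|S f| = `|f|. Proof. by case: S_iso. Qed.

Let SB f g : S (f - g) = S f - S g.
Proof. by rewrite -scaleN1r addrC S_linear scaleN1r addrC. Qed.

Let SZ c f : S (c *: f) = c *: S f.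
Proof.
have S0 : S 0 = 0 by rewrite -(subrr 0) SB subrr.
by have := S_linear c f 0; rewrite S0 !addr0.
Qed.

Let S_inj f g : S f = S g -> f = g.
Proof.
by move=> fg; apply/eqP; rewrite -subr_eq0 -normr_eq0 -S_norm SB fg subrr normr0.
Qed.

Let lens_S (f g : Lip0 e) : lens (S g) (S f) <-> lens g f.
Proof.
have SD : S (f + g) = S f + S g by have := S_linear 1 f g; rewrite !scale1r.
by rewrite /lens/= -SB -SD !S_norm.
Qed.

Section ball.
Variable n : nat.
Let r : R := n%:R.
Let r_ge0 : 0 <= r. Proof. exact: ler0n. Qed.

(** The functions that vanish on the closed ball of radius [n]. *)
Definition vanishing : set (Lip0 e) :=
  [set f | forall x, mdist e x <= r -> f x = 0].

(** The pre-annihilator in [W] of the image of these functions. *)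
Definition preannihilator : set W :=
  [set w | forall f, vanishing f -> S f w = 0].

Lemma preannihilator_closed_subspace : closed_subspace preannihilator.
Proof.
split=> [f _|c u v Nu Nv f f0|].
- by rewrite linear0.
- by rewrite dual_linear (Nu f f0) (Nv f f0) scaler0 addr0.
- have -> : preannihilator = \bigcap_(f in vanishing) (S f @^-1` [set 0]).
    by apply/seteqP; split=> w H f; exact: H.
  apply: closed_bigI => f _; apply: closed_comp; last exact: closed_eq.
  by move=> w _; exact: dual_continuous.
Qed.

(** The image of [vanishing] is the annihilator of its pre-annihilator: its unit
    ball is the lens of [S g], [g] the peak function. *)
Lemma preannihilatorK (z : dual W) :
  (forall w, preannihilator w -> z w = 0) -> exists2 f, vanishing f & z = S f.
Proof.
move=> z0; pose g := peak e r_ge0.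
have lensE f : lens (S g) (S f) <-> `|f| <= 1 /\ vanishing f.
  by rewrite lens_S; exact: lens_peak.
have Sg1 : `|S g| <= 1 by rewrite S_norm peak_norm.
have [|w wN|c [y]] := @lens_annihilator R W (S g) Sg1 _ z.
- move=> c y c0; have [_ _ /(_ y)[f <-]] := S_iso.
  rewrite -SZ S_norm => /lensE[_ f0] cf1; apply/lensE; split=> // x xr.
  by rewrite Lip0ZE f0// mulr0.
- apply: z0 => f f0; pose k := `|f| + 1.
  have k0 : 0 < k by rewrite ltr_wpDl.
  have : lens (S g) (S (k^-1 *: f)).
    apply/lensE; split=> [|x xr]; last by rewrite Lip0ZE f0// mulr0.
    rewrite normrZ normfV gtr0_norm// ler_pdivrMl// mulr1.
    by rewrite lerDl.
  move=> /wN; rewrite SZ dualZE => /eqP; rewrite mulf_eq0 invr_eq0 gt_eqF//=.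
  by move/eqP.
- have [_ _ /(_ y)[f <-]] := S_iso => /lensE[_ f0] ->.
  by exists (c *: f); rewrite ?SZ// => x xr; rewrite Lip0ZE f0// mulr0.
Qed.

Let N : completeNormedModType R := closed_span_type preannihilator.
Let en := cball_center e n : cball e r.

Let N_pre (w : N) : preannihilator (closed_span_val w).
Proof.
have /asboolP Nw := closed_span_valP w.
by apply: Nw; split=> //; exact: preannihilator_closed_subspace.
Qed.

Let restr_inj0 f : vanishing f <-> Lip0_restr n f = 0.
Proof.
split=> [f0|f0 x xr]; first by apply: Lip0P => x; exact: f0 (valP x).
exact: (congr1 (fun h : Lip0 en => h (exist _ x xr)) f0).
Qed.

Let ext (h : Lip0 en) : Lip0 e := sval (cid (McShane h)).

Let extK h : Lip0_restr n (ext h) = h.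
Proof. exact: (svalP (cid (McShane h))).1. Qed.

Let ext_norm h : `|ext h| <= `|h|.
Proof. exact: (svalP (cid (McShane h))).2. Qed.

Fact quotient_iso_subproof (h : Lip0 en) :
  (fun w : N => S (ext h) (closed_span_val w)) \in @dual_pred R N.
Proof.
apply: (@dual_mk_subproof _ _ _ `|S (ext h)|) => [c u v|w].
  exact: (dual_linear (S (ext h))).
exact: ler_dual_norm (S (ext h)) (closed_span_val w).
Qed.

(** The map induced by [S] from the Lipschitz functions on the ball of radius
    [n] to the dual of [preannihilator].  By [quotient_isoE], it does not depend
    on the choice of the extensions [ext h]. *)
Definition quotient_iso (h : Lip0 en) : dual N := Dual (quotient_iso_subproof h).

Lemma quotient_isoE f (w : N) :
  quotient_iso (Lip0_restr n f) w = S f (closed_span_val w).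
Proof.
apply/eqP; rewrite -subr_eq0.
rewrite -[_ - _]/((S (ext (Lip0_restr n f)) - S f) (closed_span_val w)).
rewrite -SB (N_pre w)//; apply/restr_inj0; apply: Lip0P => x.
have /(congr1 (fun h : Lip0 en => h x)) := extK (Lip0_restr n f).
by move=> /= E; rewrite -[LHS]/(ext (Lip0_restr n f) (val x) - f (val x)) E subrr.
Qed.

Lemma quotient_iso_extend (psi : dual N) :
  exists f, `|f| <= `|psi| /\ quotient_iso (Lip0_restr n f) = psi.
Proof.
have lv : linear (fun w : N => closed_span_val w : W) by [].
pose i : {linear N -> W} := HB.pack (fun w : N => closed_span_val w : W)
  (GRing.isLinear.Build _ _ _ _ _ lv).
have [|z [lz zp zpsi]] := @Hahn_Banach R W N i psi _
  (sublinear_scaled_norm (normr_ge0 psi)).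
  by move=> w; exact: dual_ler_norm.
have zb := linear_le_norm lz zp.
have [_ _ /(_ (Dual (dual_mk_subproof lz zb)))[f Sf]] := S_iso.
exists f; split; last first.
  by apply: dualP => w; rewrite quotient_isoE Sf; exact: zpsi.
by rewrite -S_norm Sf; exact: dual_norm_ler.
Qed.

Lemma quotient_isoP : isometric_isomorphism quotient_iso.
Proof.
split=> [c h k|h|psi].
- apply: dualP => w.
  have <- : Lip0_restr n (c *: ext h + ext k) = c *: h + k.
    rewrite -[in RHS](extK h) -[in RHS](extK k).
    exact: Lip0P.
  by rewrite quotient_isoE S_linear.
- apply/eqP; rewrite eq_le; apply/andP; split.
    apply: le_trans (ext_norm h); rewrite -S_norm.
    apply: dual_norm_ler => // w.
    exact: ler_dual_norm (S (ext h)) (closed_span_val w).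
  (* The norm-preserving lift of [quotient_iso h] restricts to [h]. *)
  have [f [fh fE]] := quotient_iso_extend (quotient_iso h).
  rewrite (le_trans _ fh)// (le_trans _ (Lip0_restr_norm n f))//.
  suff -> : Lip0_restr n f = h by [].
  have [|g /restr_inj0 g0 gE] := preannihilatorK (z := S (f - ext h)).
    move=> w Nw.
    have wP : w \in closed_span_pred preannihilator.
      by apply/asboolP; exact: sub_gen_smallest.
    have /(congr1 (fun y : dual N => y (ClosedSpan wP))) := fE.
    rewrite quotient_isoE SB => fw; rewrite dualDE dualNE fw.
    exact: subrr.
  apply/eqP; rewrite -subr_eq0 -g0 -(S_inj gE) -[in X in _ - X](extK h).
  by apply/eqP; exact: Lip0P.
- by have [f [_ <-]] := quotient_iso_extend psi; exists (Lip0_restr n f).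
Qed.

(** The identity, from the dual of the Arens-Eells space of the ball to the dual
    of [preannihilator], is weak* continuous by hypothesis. *)
Lemma preannihilator_arens_eells (w : W) (phi : dual (Lip0 e)) :
  strongly_unique_predual (Lip0_dualBanach en) ->
  preannihilator w -> (forall f, phi f = S f w) ->
  closed_span (range (@lip_eval R X e)) phi.
Proof.
move=> uniq Nw phiE.
have wP : w \in closed_span_pred preannihilator.
  by apply/asboolP; exact: sub_gen_smallest.
pose F := DualBanach quotient_isoP.
have id_iso : isometric_isomorphism (id : Lip0_dualBanach en -> F).
  exact: id_isometric_isomorphism.
have [D DP] := 
  @weak_star_continuous_ker R (Lip0_dualBanach en) F id (ClosedSpan wP)
    (fun _ _ _ => erefl) (uniq F id id_iso).
have [S0 SD _] := closed_span_closed_subspace (range (@lip_eval R X e)).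
apply: (@dual_span _ _ _ [seq restr_dual (closed_span_val m) | m <- D]) => //.
  move=> _ /mapP[m mD ->]; apply: restr_dual_arens_eells.
  by apply/asboolP; exact: closed_span_valP.
move=> f fD; rewrite phiE -(quotient_isoE f (ClosedSpan wP)).
by apply: DP => m mD; apply: (fD (restr_dual _)); exact: map_f.
Qed.

End ball.

Fact transport_subproof (w : W) :
  (fun f : Lip0 e => S f w) \in @dual_pred R (Lip0 e).
Proof.
apply: (@dual_mk_subproof _ _ _ `|w|) => [c f g|f].
  by rewrite S_linear.
by rewrite mulrC -(S_norm f); exact: ler_dual_norm.
Qed.

(** The functional [f |-> S f w]. *)
Definition transport (w : W) : dual (Lip0 e) := Dual (transport_subproof w).

Let transport_continuous : continuous transport.
Proof.
have lt : linear transport by move=> c u v; apply: dualP => f; exact: dual_linear.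
pose t : {linear W -> dual (Lip0 e)} :=
  HB.pack transport (GRing.isLinear.Build _ _ _ _ _ lt).
apply: (@bounded_linear_continuous _ _ _ t); apply/linear_boundedP.
near=> k => w.
have wk : `|transport w| <= `|w|.
  apply: dual_norm_ler => // f.
  by rewrite mulrC -(S_norm f); exact: (ler_dual_norm (S f) w).
by rewrite (le_trans wk)// ler_peMl.
Unshelve. all: by end_near. Qed.

(** A functional on [W] that vanishes wherever [transport] takes its values in
    the Arens-Eells space is the image of a function that vanishes on every
    ball. *)
Theorem transport_arens_eells : (forall n,
    strongly_unique_predual (Lip0_dualBanach (cball_center e n))) ->
  forall w, closed_span (range (@lip_eval R X e)) (transport w).
Proof.
move=> uniq w0; apply: contrapT => w0S.
have [S0 SD Sc] := closed_span_closed_subspace (range (@lip_eval R X e)).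
pose M := [set w | closed_span (range (@lip_eval R X e)) (transport w)].
have M_sub : closed_subspace M.
  split=> [|c u v Mu Mv|].
  - rewrite /M/= (_ : transport 0 = 0)//.
    by apply: dualP => f; exact: linear0.
  - rewrite /M/= (_ : transport (c *: u + v) = c *: transport u + transport v).
      exact: SD.
    by apply: dualP => f; exact: dual_linear.
  - by apply: (closed_comp _ Sc) => w _; exact: transport_continuous.
have [z [zM /eqP]] := closed_subspace_separation M_sub w0S; apply.
have [_ _ /(_ z)[f Sf]] := S_iso.
suff -> : z = 0 by [].
rewrite -Sf (_ : f = 0).
  by rewrite -(subrr 0) SB subrr.
apply: Lip0P => x.
have [n xn] : exists n : nat, mdist e x <= n%:R :> R.
  by exists (Num.bound (mdist e x)); rewrite ltW// archi_boundP// mdist_ge0.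
have [|g g0] := @preannihilatorK n z.
  by move=> w Nw; apply: zM; exact: preannihilator_arens_eells Nw _.
by rewrite -Sf => /S_inj ->; exact: g0.
Qed.

End transported_predual.

Theorem theorem3p1 (R : realType) (X : metricType R) (e : X)
    (X_complete : metric_complete X) (X_convex : metric_convex X)
    (Xn_unique : forall n : nat,
      strongly_unique_predual (Lip0_dualBanach (cball_center e n))) :
  strongly_unique_predual (Lip0_dualBanach e).
Proof.
move=> F T [T_linear T_norm T_surj].
have [iF_linear iF_norm iF_surj] := predual_isoP F.
have S_iso : isometric_isomorphism (fun f : Lip0 e => predual_iso (T f)).
  split=> [c f g|f|y].
  - by rewrite T_linear iF_linear.
  - by rewrite iF_norm T_norm.
  - have [f <-] := iF_surj y; have [g <-] := T_surj f.
    by exists g.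
apply: weak_star_continuous_pred => w.
have := transport_arens_eells S_iso X_complete X_convex Xn_unique w.
move=> /asboolP wP.
by exists (ClosedSpan wP) => f.
Qed.
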